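(* Let $K$ be an oriented, non-split alternating link in $S^3$. Let $m(K)$ be the mirror of $K$ (that is, $K$ with all crossings of a diagram switched), and let $-K$ be $K$ with the orientations of all components reversed. Then (i) $P_{-K}(x,y,z,w)=P_K(y,x,w,z)$; (ii) $P_{m(K)}(x,y,z,w)=P_K(z^{-1},w^{-1},x^{-1},y^{-1})$, where $P$ is the polynomial invariant of alternating links defined in the context.
   Context: All links are oriented and non-split. A link is alternating if it has a diagram in which each component alternates between over- and undercrossings (an alternating diagram). Crossing signs: rotate the picture so both strands point upward; the crossing is positive if the overstrand runs from lower left to upper right, negative if it runs from lower right to upper left. Tait digraph. Let $D\subset\mathbb{R}^2$ be an alternating diagram of a non-split link. Regions of $D$ are the components of the complement of the underlying 4-valent plane graph. Choose the checkerboard shading of the regions such that at every crossing, when the picture is rotated so that the overstrand runs from lower left to upper right, the top and bottom regions are the shaded ones. The Tait digraph $G=(V,E)$ is the plane digraph with one vertex in each shaded region and one edge through each crossing, joining the vertices of the two shaded regions at that crossing (loops and multiple edges allowed), directed to match the overcrossing: rotating so that the overstrand is directed from lower left to upper right, the edge points from the bottom region to the top region. An edge is positive or negative according to the sign of its crossing; $E=E_+\sqcup E_-$. Activities. Fix a root vertex $r\in V$ and a basepoint $q\in\mathbb{R}^2\setminus G$. Let $T$ be a spanning tree of $G$ (viewed as a set of edges). An edge $e\in T$ is internally semi-active if it points away from the component of $T\setminus\{e\}$ containing $r$, and internally semi-passive otherwise. For $e\in E\setminus T$, let $\mathrm{Cyc}_T(e)$ be the unique cycle in $T\cup\{e\}$,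 oriented counter-clockwise around $q$ in $\mathbb{R}^2\cup\{\infty\}$ (so that the side containing $q$ lies on its left); $e$ is externally semi-active if its direction agrees with this orientation, and externally semi-passive otherwise. Let $\iota_+(T)$, $\overline{\iota}_+(T)$ be the numbers of internally semi-active, respectively semi-passive, edges in $T\cap E_+$, and $\varepsilon_-(T)$, $\overline{\varepsilon}_-(T)$ the numbers of externally semi-active, respectively semi-passive, edges in $E_-\setminus T$. The polynomial. For an alternating diagram $D$ of $K$ with Tait digraph $G$, a root $r$, and a basepoint $q$ in a face of $G$ adjacent to $r$ (its boundary contains $r$), $$P_K(x,y,z,w)=\sum_{T}x^{-\iota_+(T)}y^{-\overline{\iota}_+(T)}z^{\varepsilon_-(T)}w^{\overline{\varepsilon}_-(T)}\in\mathbb{Z}[x^{-1},y^{-1},z,w],$$ summed over all spanning trees $T$ of $G$. It does not depend on the choice of alternating diagram or of adjacent pair $(r,q)$. *)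

(* Defs.v *)
From HB Require Import structures.
From mathcomp Require Import all_boot all_order all_fingroup all_algebra.
From mathcomp Require Export mpoly.
From Stdlib Require Import ClassicalEpsilon Relation_Operators.

Set Implicit Arguments.
Unset Strict Implicit.
Unset Printing Implicit Defensive.

Import GRing.Theory.
Local Open Scope ring_scope.

(** * Oriented link diagrams

   A link diagram on the oriented sphere S^2 = R^2 + {infinity} is a
   combinatorial map of genus 0 with over/under data.  A dart is an end of an
   arc at a node; [edge] exchanges the two ends of an arc and [node] sends a
   dart to the next one, counter-clockwise, at the same node.  Besides the
   4-valent nodes (the crossings) we allow 2-valent ones: these are plain
   points of a strand, present so that a component without crossings has a
   diagram.  They are removed or inserted by the move [subdiv_move] below.
   [over d] says that [d] lies on the overstrand of its crossing, and is
   meaningless when [d] is an end at a plain point; [out d] says that, at the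
   dart [d], the link is oriented away from the node. *)

Section Maps.
Variables (T : finType) (node edge : {perm T}).

Definition crossing_of (d : T) : bool := node (node d) != d.

(* The other dart on the same strand at the same node. *)
Definition opposite_of (d : T) : T :=
  if crossing_of d then node (node d) else node d.

(* Going along d away from its node and turning left at the other end; the
   cycle of d is the boundary of the region on the left of d. *)
Definition face_of : {perm T} := (edge * node^-1)%g.

Definition link_of : rel T := [rel x y | (y == node x) || (y == edge x)].

(* Euler's formula V - E + F = 2 C, where #|T| = 2 E. *)
Definition planar_map : bool :=
  (#|porbits node| + #|porbits edge| + #|porbits face_of| ==
   2 * n_comp link_of T + #|T|)%N.

End Maps.

Record diagram := Diagram {
  dart : finType;
  node : {perm dart};
  edge : {perm dart};
  over : pred dart;
  out : pred dart;
  node4 : forall d, node (node (node (node d))) = d;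
  node_neq : forall d, node d != d;
  edge2 : forall d, edge (edge d) = d;
  over_node : forall d, crossing_of node d -> over (node d) = ~~ over d;
  out_edge : forall d, out (edge d) = ~~ out d;
  out_opposite : forall d, out (opposite_of node d) = ~~ out d;
  planar : planar_map node edge
}.

Arguments node {_}.
Arguments edge {_}.
Arguments over {_}.
Arguments out {_}.

Definition crossing (D : diagram) (d : dart D) : bool := crossing_of node d.

Lemma mirror_over_node (D : diagram) (d : dart D) :
  crossing_of node d -> ~~ over (node d) = ~~ ~~ over d.
Proof. by move=> /over_node ->. Qed.

Definition mirror (D : diagram) : diagram :=
  @Diagram (dart D) node edge (fun d => ~~ over d) out
    (@node4 D) (@node_neq D) (@edge2 D) (@mirror_over_node D)
    (@out_edge D) (@out_opposite D) (@planar D).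

Lemma reverse_out_edge (D : diagram) (d : dart D) :
  ~~ out (edge d) = ~~ ~~ out d.
Proof. by rewrite out_edge. Qed.

Lemma reverse_out_opposite (D : diagram) (d : dart D) :
  ~~ out (opposite_of node d) = ~~ ~~ out d.
Proof. by rewrite out_opposite. Qed.

Definition reverse (D : diagram) : diagram :=
  @Diagram (dart D) node edge over (fun d => ~~ out d)
    (@node4 D) (@node_neq D) (@edge2 D) (@over_node D)
    (@reverse_out_edge D) (@reverse_out_opposite D) (@planar D).

(** * Link types

   By Reidemeister's theorem, an oriented link in S^3 up to isotopy is a
   diagram up to the relation [link_equiv] generated by orientation-preserving
   isomorphisms of planar maps and the Reidemeister moves.  A planar map
   records no relative position of the components of a disconnected diagram;
   this does not affect the link type. *)

(* B is, up to renaming its darts, obtained from A by erasing the darts in X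
   and replacing [node] and [edge] by [nA] and [eA] on the remaining ones. *)
Definition rewired (A B : diagram) (X : {set dart A})
    (nA eA : dart A -> dart A) : Prop :=
  exists f : dart B -> dart A,
    [/\ injective f /\ (forall a, (a \in codom f) = (a \notin X)),
        forall b, f (node b) = nA (f b),
        forall b, f (edge b) = eA (f b),
        forall b, out (f b) = out b
      & forall b, crossing b -> over (f b) = over b].

Definition iso_move (A B : diagram) : Prop :=
  @rewired A B set0 node edge.

(* Erase a plain point and join its two arcs. *)
Definition subdiv_move (A B : diagram) : Prop :=
  exists d : dart A,
    [/\ ~~ crossing d, edge d != node d &
        @rewired A B [set d; node d] node
          (fun x => if edge x == d then edge (node d)
                    else if edge x == node d then edge d else edge x)].

(* First Reidemeister move: the region between d and node d is a monogon.  The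
   crossing becomes a plain point of the strand. *)
Definition R1_move (A B : diagram) : Prop :=
  exists d : dart A,
    [/\ crossing d, edge d = node d &
        let d2 := node (node d) in let d3 := node d2 in
        @rewired A B [set d; node d]
          [eta node with d2 |-> d3, d3 |-> d2] edge].

(* Second Reidemeister move: the region between d and node d is a bigon, with
   second corner between b and a = node b, and the arc {d, a} is over (or under)
   at both ends.  Each of the two strands keeps one plain point. *)
Definition R2_move (A B : diagram) : Prop :=
  exists d : dart A,
    let a := edge d in let b := edge (node d) in
    [/\ crossing d, crossing a, node b = a, over a = over d &
        let d2 := node (node d) in let d3 := node d2 in
        let a2 := node (node a) in let b2 := node (node b) in
        @rewired A B [set d; node d; a; b]
          [eta node with d2 |-> a2, a2 |-> d2, d3 |-> b2, b2 |-> d3] edge].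

(* Third Reidemeister move: the region with corners between p_i and node p_i is
   a triangle with distinct crossings, and the over/under pattern is not the
   cyclic one.  The move slides each strand past the opposite crossing; keeping
   the same darts at each crossing, this exchanges, on each of the three
   strands, the outer dart at either end of the triangle side with the inner
   dart at the other end. *)
Definition R3_swap (A : diagram) (tri : {set dart A}) (x : dart A) : dart A :=
  if x \in tri then node (node (edge x))
  else if node (node x) \in tri then edge (node (node x)) else x.

Definition R3_move (A B : diagram) : Prop :=
  exists p0 p1 p2 : dart A,
    let tri := [set p0; node p0; p1; node p1; p2; node p2] in
    [/\ [/\ crossing p0, crossing p1 & crossing p2],
        [/\ edge p0 = node p1, edge p1 = node p2 & edge p2 = node p0],
        [/\ p1 \notin porbit node p0, p2 \notin porbit node p1
          & p0 \notin porbit node p2],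
        ~~ ((over p0 == over p1) && (over p1 == over p2))
      & @rewired A B set0 node (fun x => R3_swap tri (edge (R3_swap tri x)))].

Definition move (A B : diagram) : Prop :=
  iso_move A B \/ subdiv_move A B \/ R1_move A B \/ R2_move A B \/ R3_move A B.

Definition link_equiv : diagram -> diagram -> Prop :=
  clos_refl_sym_trans diagram move.

Definition connected (D : diagram) : bool :=
  n_comp (link_of (@node D) edge) (dart D) == 1%N.

(* The link presented by K is non-empty and not split. *)
Definition nonsplit (K : diagram) : Prop :=
  forall D, link_equiv K D -> connected D.

(* [run d d']: following the link away from its node along d, one arrives at d'
   after crossing only plain points. *)
Inductive run (D : diagram) : dart D -> dart D -> Prop :=
| run_edge d : run d (edge d)
| run_plain d d' : run d d' -> ~~ crossing d' -> run d (edge (node d')).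

Definition alternating (D : diagram) : Prop :=
  forall d d' : dart D,
    crossing d -> crossing d' -> run d d' -> over d' = ~~ over d.

Definition alternating_link (K : diagram) : Prop :=
  exists2 D, link_equiv K D & alternating D.

(** * The Tait digraph

   A region of a connected diagram is the cycle of [face_of] along its
   boundary.  The vertices of the Tait digraph are the shaded regions.  An edge,
   i.e. a crossing, is represented by the dart along which the overstrand leaves
   it.  If this dart points to the upper right, the corners between d and
   node d, between node d and node (node d), and so on, are the top, left,
   bottom and right ones.  Each face of the Tait digraph, as a plane graph,
   contains exactly one unshaded region, by which it is represented. *)

Section Tait.
Variable D : diagram.

Definition face : {perm dart D} := face_of node edge.
Definition region (d : dart D) : {set dart D} := porbit face d.

Definition tait_shading (S : {set {set dart D}}) : Prop :=
  [/\ S \subset porbits face,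
      forall d, (region (edge d) \in S) = (region d \notin S)
    & forall d, crossing d -> over d -> region d \in S].

Definition tait_edges : {set dart D} :=
  [set d | [&& crossing d, over d & out d]].

Definition head (d : dart D) : {set dart D} := region d.
Definition tail (d : dart D) : {set dart D} := region (node (node d)).
Definition left_face (d : dart D) : {set dart D} := region (node d).
Definition right_face (d : dart D) : {set dart D} :=
  region (node (node (node d))).

(* With the overstrand going from lower left to upper right, the understrand
   leaves through the upper left corner. *)
Definition positive (d : dart D) : bool := out (node d).

(* Adjacency of vertices along the edges in A. *)
Definition vadj (A : {set dart D}) : rel {set dart D} :=
  [rel u v | [exists d in A, ((tail d == u) && (head d == v))
                          || ((tail d == v) && (head d == u))]].

(* Adjacency of faces across the edges outside C. *)
Definition fadj (C : {set dart D}) : rel {set dart D} :=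
  [rel u v | [exists d in tait_edges :\: C,
                 ((left_face d == u) && (right_face d == v))
              || ((left_face d == v) && (right_face d == u))]].

Definition degree (A : {set dart D}) (v : {set dart D}) : nat :=
  (#|[set d in A | tail d == v]| + #|[set d in A | head d == v]|)%N.

Definition is_cycle (C : {set dart D}) : bool :=
  [&& C != set0,
      [forall v, (degree C v == 0%N) || (degree C v == 2)]
    & [forall c in C, forall d in C, connect (vadj C) (tail c) (tail d)]].

Definition spanning_tree (S : {set {set dart D}}) (T : {set dart D}) : bool :=
  [&& T \subset tait_edges,
      [forall u in S, forall v in S, connect (vadj T) u v]
    & ~~ [exists C : {set dart D}, (C \subset T) && is_cycle C]].

(* The unique cycle in T together with e. *)
Definition Cyc (T : {set dart D}) (e : dart D) : {set dart D} :=
  odflt set0 [pick C : {set dart D} | (C \subset e |: T) && is_cycle C].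

Definition int_semi_active (r : {set dart D}) (T : {set dart D})
  (e : dart D) : bool := connect (vadj (T :\ e)) r (tail e).

(* The sides of Cyc T e are the classes of faces under adjacency across edges
   outside Cyc T e.  When Cyc T e has the face q on its left, it traverses e in
   the direction of e iff q is on the same side as the face on the left of e. *)
Definition ext_semi_active (q : {set dart D}) (T : {set dart D})
  (e : dart D) : bool := connect (fadj (Cyc T e)) q (left_face e).

Definition iota_pos (r : {set dart D}) (T : {set dart D}) : nat :=
  #|[set e in T | positive e && int_semi_active r T e]|.
Definition iota_bar_pos (r : {set dart D}) (T : {set dart D}) : nat :=
  #|[set e in T | positive e && ~~ int_semi_active r T e]|.
Definition eps_neg (q : {set dart D}) (T : {set dart D}) : nat :=
  #|[set e in tait_edges :\: T | ~~ positive e && ext_semi_active q T e]|.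
Definition eps_bar_neg (q : {set dart D}) (T : {set dart D}) : nat :=
  #|[set e in tait_edges :\: T | ~~ positive e && ~~ ext_semi_active q T e]|.

(* The root r and the face q of the Tait digraph are adjacent iff the regions r
   and q share an arc of the diagram. *)
Definition adjacent_pair (S : {set {set dart D}}) (r q : {set dart D}) : Prop :=
  r \in S /\ exists d, r = region d /\ q = region (edge d).

(* An element of Z[x^-1, y^-1, z, w]; the four variables of {mpoly int[4]}
   are x^-1, y^-1, z, w, in this order. *)
Definition tree_polynomial (S : {set {set dart D}}) (r q : {set dart D}) :
    {mpoly int[4]} :=
  \sum_(T : {set dart D} | spanning_tree S T)
     'X_(inord 0) ^+ iota_pos r T * 'X_(inord 1) ^+ iota_bar_pos r T *
     'X_(inord 2) ^+ eps_neg q T * 'X_(inord 3) ^+ eps_bar_neg q T.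

End Tait.

(** * The polynomial invariant *)

(* p is computed from some alternating diagram of the link K. *)
Definition computes_P (K : diagram) (p : {mpoly int[4]}) : Prop :=
  exists (D : diagram) (S : {set {set dart D}}) (r q : {set dart D}),
    [/\ link_equiv K D, alternating D, tait_shading S, adjacent_pair S r q
      & p = tree_polynomial S r q].

(* Independence of the choices: the theorem on which the definition of P
   rests. *)
Definition P_well_defined : Prop :=
  forall K, nonsplit K -> alternating_link K ->
  forall p p', computes_P K p -> computes_P K p' -> p = p'.

Definition P (K : diagram) : {mpoly int[4]} :=
  epsilon (inhabits 0) (computes_P K).

(* The value p(x, y, z, w) of p in Z[x^-1, y^-1, z, w] at units of a
   commutative ring. *)
Definition laurent_eval (R : comUnitRingType) (p : {mpoly int[4]})
    (x y z w : R) : R :=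
  mmap (fun m : int => m%:~R) (tnth [tuple x^-1; y^-1; z; w]) p.

(* Main.v *)
(* Reversing the link reverses every edge of the Tait digraph and keeps signs,
   so semi-active and semi-passive edges are exchanged.  Switching all crossings
   replaces the Tait digraph by its plane dual and changes every sign;
   complements of spanning trees are the spanning trees of the dual, and the
   internal activity of an edge in the dual is its external activity.  Both
   statements rest on the fact that, in the sphere, the even sets of edges are
   exactly the cuts of the dual graph: hence, for an edge e outside a spanning
   tree T, the two sides of Cyc_T(e) are the two components of the dual tree of
   T after removal of e.  This fact is obtained over F_2 by comparing ranks,
   using Euler's formula. *)
From Pilot Require Import Defs.
From mathcomp Require Import all_boot all_order all_fingroup all_algebra.
From mathcomp Require Import zify.
From Stdlib Require Import ClassicalEpsilon Relation_Operators.
Import Pilot.Defs(over, head).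

Set Implicit Arguments.
Unset Strict Implicit.
Unset Printing Implicit Defensive.

Import GRing.Theory.

(** * Cycles and spanning trees of finite multigraphs *)

(** No Jordan curve is available: the sides of a cycle are classes of faces under adjacency, and
    that there are two of them, separated by every edge of the cycle, has to be proved. A cycle is
    therefore weakened to a set of edges with all degrees even, and its sides to the two values of a
    function on faces whose coboundary over F_2 is that set. Such a function can only show that
    faces are separated; that faces are joined comes from the tree, through its dual. The mirror
    image has a second difficulty. The direction of the dual edge depends on the sign of the
    crossing: it crosses a positive edge from right to left, a negative one from left to right.
    Activities still correspond without exchange, because the polynomial counts only positive
    internal and negative external edges, and each of these two classes has a single convention.
    Finally, [P] is obtained by choice, so some alternating diagram with a shading must be
    exhibited. The shading is not part of a diagram; it is built from the alternation of
    crossings. *)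

Section Graph.
Variables (V E : finType) (t h : E -> V).
Implicit Types (A B C : {set E}) (u v x : V).

(** With the ends as parameters, the bodies are those of [vadj], [fadj], [degree] and [is_cycle].
    Hence one theory serves the Tait digraph and its dual by conversion. *)
Definition adj (A : {set E}) : rel V :=
  [rel u v | [exists d in A, ((t d == u) && (h d == v))
                          || ((t d == v) && (h d == u))]].

Definition deg (A : {set E}) (v : V) : nat :=
  #|[set d in A | t d == v]| + #|[set d in A | h d == v]|.

Definition cyc (C : {set E}) : bool :=
  [&& C != set0,
      [forall v, (deg C v == 0) || (deg C v == 2)]
    & [forall c in C, forall d in C, connect (adj C) (t c) (t d)]].

Definition spans (S : {set V}) (A : {set E}) : bool :=
  [forall u in S, forall v in S, connect (adj A) u v].

Definition acyclic (A : {set E}) : bool :=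
  ~~ [exists C : {set E}, (C \subset A) && cyc C].

Lemma adj_sym A : symmetric (adj A).
Proof. by move=> u v; apply: eq_existsb => d; rewrite orbC. Qed.

Lemma connect_adj_sym A : connect_sym (adj A).
Proof. exact/sym_connect_sym/adj_sym. Qed.

Lemma adj_end A e : e \in A -> adj A (t e) (h e).
Proof. by move=> eA; apply/existsP; exists e; rewrite eA !eqxx. Qed.

Lemma sub_adj A B : A \subset B -> subrel (connect (adj A)) (connect (adj B)).
Proof.
move=> sAB; apply: connect_sub => u v /existsP[d /andP[dA Hd]].
by apply: connect1; apply/existsP; exists d; rewrite (subsetP sAB).
Qed.

Lemma adj_invariant (T : eqType) (f : V -> T) A u v :
  {in A, forall e, f (t e) = f (h e)} -> connect (adj A) u v -> f u = f v.
Proof.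
move=> fA /connectP[p]; elim: p u => [|w p IHp] u /=; first by move=> _ ->.
case/andP=> /existsP[d /andP[dA Hd]] wp vE; rewrite -(IHp w wp vE).
by case/orP: Hd => /andP[/eqP <- /eqP <-]; rewrite fA.
Qed.

Lemma degE A v : deg A v = \sum_(e in A) ((t e == v) + (h e == v)).
Proof.
rewrite big_split /deg -!sum1_card.
by congr (_ + _); rewrite [RHS]big_mkcond /= big_mkcond; apply: eq_bigr => e _;
  rewrite inE; case: (e \in A) => //=; case: eqP.
Qed.

Lemma deg0 v : deg set0 v = 0.
Proof. by rewrite degE big_set0. Qed.

Lemma degU1 A e v : e \notin A ->
  deg (e |: A) v = (t e == v) + (h e == v) + deg A v.
Proof. by move=> eA; rewrite !degE big_setU1. Qed.

Lemma degD1 A e v : e \in A ->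
  deg A v = (t e == v) + (h e == v) + deg (A :\ e) v.
Proof. by move=> eA; rewrite !degE (big_setD1 e). Qed.

Lemma deg_eq0 A v : {in A, forall e, t e != v /\ h e != v} -> deg A v = 0.
Proof.
by move=> nA; rewrite degE big1 // => e /nA[/negbTE-> /negbTE->].
Qed.

(** No edge of [A] leaves [U], so each edge contributes 2 or 0 to the sum. *)
Lemma handshake A (U : {pred V}) :
  {in A, forall e, (t e \in U) = (h e \in U)} ->
  ~~ odd (\sum_(x in U) deg A x).
Proof.
move=> UA; under eq_bigr do rewrite degE.
have one x : \sum_(i in U) (x == i) = (x \in U).
  case Ux: (x \in U).
    rewrite (bigD1 x) //= eqxx big1 // => i /andP[_].
    by rewrite eq_sym => /negbTE->.
  by rewrite big1 // => i Ui; case: eqP => // xi; rewrite xi Ui in Ux.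
rewrite exchange_big /= (eq_bigr (fun e => (h e \in U).*2)) => [|e eA].
  by elim/big_rec: _ => // e n _; rewrite oddD odd_double.
by rewrite -addnn big_split /= !one UA.
Qed.

(** [B] consists of the edges of a simple path. The clause on ends is for the induction: the next
    edge has the fresh vertex [u] as an end, hence is not yet in [B]. The bound at [v] is for
    [minimal_even_cyc], where parity alone would not give degree 2. *)
Lemma path_boundary A u v p :
  path (adj A) u p -> uniq (u :: p) -> last u p = v ->
  exists B, [/\ B \subset A, forall x, odd (deg B x) = (x == u) (+) (x == v),
    {in B, forall e, (t e \in u :: p) && (h e \in u :: p)} & deg B v <= 1].
Proof.
elim: p u => [|w p IHp] u /= => [_ _ <-|].
  by exists set0; split=> [|x|e|]; rewrite ?sub0set ?deg0 ?addbb ?inE.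
case/andP=> /existsP[d /andP[dA Hd]] wp /andP[u_wp wp_uniq] vE.
have [B [sBA oddB endB degB]] := IHp w wp wp_uniq vE.
have uw : u != w by apply: contraNneq u_wp => ->; rewrite mem_head.
have th x : (t d == x) + (h d == x) = (u == x) + (w == x).
  by case/orP: Hd => /andP[/eqP-> /eqP->] //; rewrite addnC.
have dB : d \notin B.
  apply/negP => /endB /andP[]; case/orP: Hd => /andP[/eqP-> /eqP->] H1 H2.
    by rewrite H1 in u_wp.
  by rewrite H2 in u_wp.
have uv : u != v.
  by apply: contraNneq u_wp => ->; rewrite -vE mem_last.
exists (d |: B); split.
- by rewrite subUset sub1set dA.
- move=> x; rewrite degU1 // th oddD oddB oddD !oddb ![x == _]eq_sym.
  by case: (u == x); case: (w == x); case: (v == x).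
- move=> e /setU1P[->|/endB/andP[H1 H2]]; last first.
    by rewrite !(in_cons u) H1 H2 !orbT.
  by case/orP: Hd => /andP[/eqP-> /eqP->]; rewrite !inE !eqxx !orbT.
rewrite degU1 // th (negbTE uv) /=; case: eqP => // wv.
(* When [w = v], the degree of [B] at [v] is even and at most 1, hence 0. *)
have := oddB v; rewrite wv addbb; move: degB.
by case: (deg B v) => [|[]].
Qed.

Lemma connect_boundary A u v : connect (adj A) u v ->
  exists B, [/\ B \subset A, forall x, odd (deg B x) = (x == u) (+) (x == v)
    & deg B v <= 1].
Proof.
case/connectP=> p Ap ->; case/shortenP: Ap => q Aq q_uniq _.
by have [B [? ? _ ?]] := path_boundary Aq q_uniq erefl; exists B.
Qed.

(** The edges of [C] in one component form an even set, so minimality gives connectedness. For the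
    degree at [v], take an edge [d] of [C] at [v]: a simple path in [C :\ d] joins its ends, and
    this path closed by [d] is even, hence equal to [C]. *)
Lemma minimal_even_cyc C : C != set0 -> (forall x, ~~ odd (deg C x)) ->
  (forall B, B \subset C -> B != set0 -> (forall x, ~~ odd (deg B x)) ->
     B = C) ->
  cyc C.
Proof.
move=> C0 evenC minC; apply/and3P; split=> //; last first.
  apply/forall_inP => c cC; apply/forall_inP => d dC.
  pose B := [set e in C | connect (adj C) (t c) (t e)].
  suff BC : B = C by have: d \in B by [rewrite BC]; rewrite inE => /andP[].
  apply: minC; first by apply/subsetP => e; rewrite inE => /andP[].
    by apply/set0Pn; exists c; rewrite inE cC connect0.
  have conn_h e : e \in C ->
      connect (adj C) (t c) (h e) = connect (adj C) (t c) (t e).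
    move=> eC; rewrite !(connect_adj_sym _ (t c)); apply/esym.
    exact/same_connect/connect1/adj_end/eC/connect_adj_sym.
  move=> x; case cx: (connect (adj C) (t c) x).
    suff -> : deg B x = deg C x by [].
    rewrite !degE [RHS](big_setID B) /= [X in _ + X]big1 ?addn0 => [|e].
      by apply: eq_bigl => e; rewrite !inE; case: (e \in C).
    rewrite !inE => /andP[+ eC]; rewrite eC /= => nce; move: (nce).
    rewrite -conn_h // => nce'.
    by rewrite -[RHS]/(0 + 0); congr (_ + _); apply/eqP; rewrite eqb0;
      [apply: contraNneq nce => -> | apply: contraNneq nce' => ->].
  rewrite deg_eq0 // => e; rewrite inE => /andP[eC ce]; move: (ce).
  rewrite -conn_h // => ce'.
  by split; apply: contraFneq cx => <-.
apply/forallP => v; apply/orP.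
have [-> | dv] := posnP (deg C v); [by left | right].
suff : deg C v <= 2.
  by move: dv (evenC v); case: (deg C v) => [|[|[|]]].
have [d dC dv'] : exists2 d, d \in C & (t d == v) || (h d == v).
  apply/exists_inP/contraT; rewrite negb_exists => /forallP noC.
  rewrite deg_eq0 // in dv => e eC.
  by have := noC e; rewrite eC negb_or => /andP[].
wlog : / exists u, forall x, (t d == x) + (h d == x) = (u == x) + (v == x).
  apply; case/orP: dv' => /eqP <-; last by exists (t d).
  by exists (h d) => x; rewrite addnC.
case=> u th; have [uv | uv] := eqVneq u v.
  (* A loop is an even set by itself, so it is all of [C]. *)
  have dd x : deg [set d] x = (u == x) + (u == x).
    by rewrite degE big_set1 th uv.
  have <- : [set d] = C; last by rewrite dd; case: (u == v).
  apply: minC; rewrite ?sub1set //;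
    last by move=> x; rewrite dd addnn odd_double.
  by apply/set0Pn; exists d; rewrite inE.
have oddCd x : odd (deg (C :\ d) x) = (u == x) (+) (v == x).
  move: (evenC x); rewrite (degD1 _ dC) th.
  move: (deg _ x) => n; rewrite !oddD !oddb.
  by case: (u == x); case: (v == x); case: (odd n).
have uCv : connect (adj (C :\ d)) u v.
  (* Otherwise [u] would be the only vertex of odd degree in its component of [C :\ d], against
     [handshake]. *)
  apply/negP => nuv.
  pose U := [pred x | connect (adj (C :\ d)) u x].
  have Ud : {in C :\ d, forall e, (t e \in U) = (h e \in U)}.
    move=> e eC; rewrite !inE !(connect_adj_sym _ u).
    exact/same_connect/connect1/adj_end/eC/connect_adj_sym.
  have /negP[] := handshake Ud.
  rewrite (bigD1 u) ?inE ?connect0 //= oddD oddCd eqxx.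
  rewrite eq_sym in uv; rewrite (negbTE uv) /=.
  elim/big_rec: _ => // x n /andP[ux xu] on.
  rewrite oddD (negbTE on) oddCd eq_sym (negbTE xu) addbF /=.
  by apply/eqP=> vx; rewrite vx in nuv.
have [B [sB oddB degB]] := connect_boundary uCv.
have dB : d \notin B by apply/negP => /(subsetP sB); rewrite !inE eqxx.
have <- : d |: B = C; last by rewrite degU1 // th eqxx (negbTE uv); lia.
apply: minC.
- by rewrite subUset sub1set dC (subset_trans sB) ?subsetDl.
- by apply/set0Pn; exists d; rewrite !inE eqxx.
move=> x; rewrite degU1 // th oddD oddB oddD !oddb ![x == _]eq_sym.
by case: (u == x); case: (v == x).
Qed.

Lemma acyclic_even A B : acyclic A -> B \subset A ->
  (forall x, ~~ odd (deg B x)) -> B = set0.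
Proof.
move=> /existsPn acA sBA evenB; apply/eqP/contraT => B0.
pose even (C : {set E}) := [forall x, ~~ odd (deg C x)].
have [|C] := @arg_minnP _ B
  (fun C : {set E} => [&& C \subset A, C != set0 & even C]) (fun C => #|C|).
  by rewrite sBA B0; apply/forallP.
case/and3P=> sCA C0 /forallP evenC minC.
have /negP[] := acA C; rewrite sCA /=.
apply: minimal_even_cyc => // F sFC F0 /forallP evenF.
by apply/eqP; rewrite eqEcard sFC minC // (subset_trans sFC) // F0.
Qed.

Lemma cyc_even C x : cyc C -> ~~ odd (deg C x).
Proof. by case/and3P=> _ /forallP/(_ x)/orP[]/eqP->. Qed.

Lemma cyc_neq0 C : cyc C -> C != set0.
Proof. by case/and3P. Qed.

(** This turns acyclicity into a statement on degrees modulo 2, which can be compared with cuts of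
    the dual graph and transported along maps of edges. *)
Lemma even_acyclicP A :
  reflect (forall B, B \subset A -> (forall x, ~~ odd (deg B x)) -> B = set0)
          (acyclic A).
Proof.
apply: (iffP idP) => [acA B|acA]; first exact: acyclic_even.
apply/existsPn => C; apply/negP => /andP[sCA cycC].
have /eqP[] := cyc_neq0 cycC; apply: acA => // x; exact: cyc_even.
Qed.

Lemma acyclic_bridge A e : acyclic A -> e \in A ->
  ~~ connect (adj (A :\ e)) (t e) (h e).
Proof.
move=> /even_acyclicP acA eA; apply/negP => /connect_boundary[B [sB oddB _]].
have eB : e \notin B by apply/negP => /(subsetP sB); rewrite !inE eqxx.
have/setP/(_ e) : e |: B = set0.
  apply: acA => [|x].
    by rewrite subUset sub1set eA (subset_trans sB) ?subsetDl.
  rewrite degU1 // oddD oddB oddD !oddb ![x == _]eq_sym.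
  by case: (_ == x); case: (_ == x).
by rewrite !inE eqxx.
Qed.

(** Reaching both ends would contradict [acyclic_bridge]; if neither were reached, no edge of [A]
    would leave the component of [r], against spanning. Semi-passivity thus becomes reachability of
    the opposite end. *)
Lemma acyclic_ends S A e r : spans S A -> acyclic A -> e \in A ->
  r \in S -> t e \in S ->
  connect (adj (A :\ e)) r (h e) = ~~ connect (adj (A :\ e)) r (t e).
Proof.
move=> /forall_inP spS acA eA rS teS; have br := acyclic_bridge acA eA.
case rt: (connect _ r (t e)) => /=.
  apply/negP => rh; case/negP: br; apply: connect_trans rh.
  by rewrite connect_adj_sym.
apply/contraT => rh.
have rte := forall_inP (spS r rS) (t e) teS.
rewrite -rt -(adj_invariant (f := connect (adj (A :\ e)) r) _ rte) //.
move=> d dA; have [-> | de] := eqVneq d e; first by rewrite rt (negbTE rh).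
rewrite !(connect_adj_sym _ r); apply/same_connect/connect1/adj_end.
  exact: connect_adj_sym.
by rewrite !inE de.
Qed.

(** Ensures that [Cyc] never takes its default value [set0]. *)
Lemma spans_cyc S A e : spans S A -> e \notin A -> t e \in S -> h e \in S ->
  exists2 C : {set E}, C \subset e |: A & cyc C.
Proof.
move=> /forall_inP spS eA teS heS.
have [B [sBA oddB _]] := connect_boundary (forall_inP (spS _ teS) _ heS).
have eB : e \notin B by apply: contra eA => /(subsetP sBA).
suff /existsP[C /andP[? ?]] : [exists C : {set E}, (C \subset e |: A) && cyc C].
  by exists C.
apply: contraT => /even_acyclicP acA.
have /setP/(_ e) : e |: B = set0; last by rewrite !inE eqxx.
apply: acA => [|x]; first by rewrite setUS.
rewrite degU1 // oddD oddB oddD !oddb ![x == _]eq_sym.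
by case: (_ == x); case: (_ == x).
Qed.

End Graph.

(** * Undirected notions under a relabelling of edges that may flip some of them *)

Section Transport.
Variables (V E E' : finType) (t h : E -> V) (t' h' : E' -> V).
Variables (X : {set E}) (f : E -> E').
Hypothesis f_inj : {in X &, injective f}.
Hypothesis f_ends : {in X, forall e,
  (t' (f e) = t e /\ h' (f e) = h e) \/ (t' (f e) = h e /\ h' (f e) = t e)}.
Implicit Types (A C : {set E}).

Lemma adj_imset A : A \subset X -> adj t' h' (f @: A) =2 adj t h A.
Proof.
move=> /subsetP sAX u v; apply/existsP/existsP => -[e /andP[eA Hd]].
  case/imsetP: eA => d dA ed; exists d; rewrite dA /=; move: Hd.
  rewrite {}ed; case: (f_ends (sAX d dA)) => -[-> ->] //.
  by rewrite orbC andbC [in X in _ || X]andbC.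
exists (f e); rewrite imset_f //=; case: (f_ends (sAX e eA)) => -[-> ->] //.
by rewrite orbC andbC [in X in _ || X]andbC.
Qed.

Lemma connect_adj_imset A : A \subset X ->
  connect (adj t' h' (f @: A)) =2 connect (adj t h A).
Proof. by move=> sAX; apply/eq_connect/adj_imset. Qed.

Lemma spans_imset S A : A \subset X -> spans t' h' S (f @: A) = spans t h S A.
Proof.
move=> sAX; apply: eq_forallb_in => u _; apply: eq_forallb_in => v _.
exact: connect_adj_imset.
Qed.

Lemma deg_imset A v : A \subset X -> deg t' h' (f @: A) v = deg t h A v.
Proof.
move=> /subsetP sAX; rewrite !degE big_imset => [|x y xA yA]; last first.
  by apply: f_inj; apply: sAX.
apply: eq_bigr => e eA; case: (f_ends (sAX e eA)) => -[-> ->] //.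
exact: addnC.
Qed.

Lemma acyclic_imset A : A \subset X -> acyclic t' h' (f @: A) = acyclic t h A.
Proof.
move=> sAX; apply/even_acyclicP/even_acyclicP => acA B sBA evenB.
  apply/eqP; rewrite -(imset_eq0 f); apply/eqP/acA => [|x].
    exact: imsetS.
  by rewrite deg_imset // (subset_trans sBA).
have fB : B = f @: [set e in A | f e \in B].
  apply/setP=> b; apply/idP/imsetP => [bB|[e]]; last first.
    by rewrite inE => /andP[_ ?] ->.
  have /imsetP[e eA be] := subsetP sBA b bB.
  by exists e; rewrite // inE eA -be.
have sB' : [set e in A | f e \in B] \subset A.
  by apply/subsetP => e; rewrite inE => /andP[].
rewrite fB; suff -> : [set e in A | f e \in B] = set0 by rewrite imset0.
apply: acA => // x.
by rewrite -deg_imset ?(subset_trans sB') // -fB.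
Qed.

End Transport.

(** * Dual plane graphs *)

Section Incidence.
Variables (V E : finType) (X : {set E}).

Local Open Scope ring_scope.

Let F2 : fieldType := 'F_2.

Lemma oppF2 (x : F2) : - x = x.
Proof. by rewrite oppr_pchar2 // pchar_Fp. Qed.

Lemma natF2_eq0 n : (n%:R == 0 :> F2) = ~~ odd n.
Proof. by rewrite -(dvdn_pcharf (pchar_Fp (isT : prime 2))) dvdn2. Qed.

Definition incidence (a b : E -> V) (U : {set V}) : 'M[F2]_(#|U|, #|X|) :=
  \matrix_(i, j)
    ((a (enum_val j) == enum_val i) + (b (enum_val j) == enum_val i))%N%:R.

(** Extension by 0 of a vector indexed by [U] to all vertices, so that it can be evaluated at the
    ends of an edge. *)
Definition cochain (U : {set V}) (w : 'rV[F2]_#|U|) (x : V) : F2 :=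
  \sum_i w 0 i * (x == enum_val i)%:R.

Lemma cochainE (U : {set V}) (w : 'rV[F2]_#|U|) i :
  cochain w (enum_val i) = w 0 i.
Proof.
rewrite /cochain (bigD1 i) //= eqxx mulr1 big1 ?addr0 // => j /negPf ji.
by rewrite (inj_eq enum_val_inj) eq_sym ji mulr0.
Qed.

Lemma mul_incidence (a b : E -> V) (U : {set V}) (w : 'rV_#|U|) j :
  (w *m incidence a b U) 0 j =
  cochain w (a (enum_val j)) + cochain w (b (enum_val j)).
Proof.
rewrite mxE; under eq_bigr do rewrite mxE natrD mulrDr.
by rewrite big_split.
Qed.

(** A vector in the left kernel takes equal values at the two ends of each edge, hence is constant
    by connectivity: the kernel has dimension at most 1. *)
Lemma rank_incidence (a b : E -> V) (U : {set V}) :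
  spans a b U X -> (#|U| <= (\rank (incidence a b U)).+1)%N.
Proof.
move=> spU.
have ker_le : (kermx (incidence a b U) <= (const_mx 1 : 'rV_#|U|))%MS.
  apply/rV_subP => w /sub_kermxP wM.
  have wab : {in X, forall e, cochain w (a e) = cochain w (b e)}.
    move=> e eX; move/rowP/(_ (enum_rank_in eX e)): wM.
    rewrite mul_incidence enum_rankK_in // mxE => /eqP.
    by rewrite addr_eq0 oppF2 => /eqP.
  have wconst i j : w 0 i = w 0 j.
    rewrite -!cochainE; apply: (adj_invariant wab).
    exact: forall_inP (forall_inP spU _ (enum_valP i)) _ (enum_valP j).
  (* The constant is read off at any index; if [U] is empty there is none, and the equality of rows
     is vacuous. *)
  apply/submxP; case: (pickP [pred i : 'I_#|U| | true]) => [i _|no_i].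
    exists (w 0 i)%:M; apply/rowP => j.
    by rewrite !mxE big_ord_recl big_ord0 !mxE eqxx mulr1n mulr1 addr0.
  by exists 0; apply/rowP => j; have := no_i j.
have := mxrankS ker_le; rewrite mxrank_ker.
have := rank_leq_row (const_mx 1 : 'rV[F2]_#|U|); lia.
Qed.

End Incidence.

(* Two plane graphs with the same edges X, vertices S and S', and ends t, h
   and l, r, related to each other as dual plane graphs on the sphere are. *)
Record dual_pair (V E : finType) (t h l r : E -> V) (S S' : {set V})
    (X : {set E}) : Prop := DualPair {
  ends_in : {in X, forall e, (t e \in S) && (h e \in S)};
  dual_ends_in : {in X, forall e, (l e \in S') && (r e \in S')};
  dual_pair_spans : spans t h S X;
  dual_pair_dual_spans : spans l r S' X;
  orthogonal : {in S & S', forall u v,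
    ~~ odd (\sum_(e in X)
        ((t e == u) + (h e == u)) * ((l e == v) + (r e == v)))};
  euler : #|S| + #|S'| = #|X| + 2
}.

Section DualPair.
Variables (V E : finType) (t h l r : E -> V) (S S' : {set V}) (X : {set E}).
Hypothesis dual_thlr : dual_pair t h l r S S' X.

Lemma dual_pairC : dual_pair l r t h S' S X.
Proof.
case: dual_thlr => ? ? ? ? orth eul; split=> //; last by rewrite addnC.
by move=> u v uS vS; under eq_bigr do rewrite mulnC; apply: orth.
Qed.

(** Modulo 2, a cut is the sum of the stars of the dual vertices in [W], since an edge with both
    ends in [W] is counted twice. Each star is orthogonal to the star of [x]. *)
Lemma cut_even (W : pred V) x :
  ~~ odd (deg t h [set e in X | W (l e) (+) W (r e)] x).
Proof.
case: dual_thlr => th_in lr_in _ _ orth _.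
have [xS | xS] := boolP (x \in S); last first.
  rewrite deg_eq0 // => e; rewrite inE => /andP[/th_in/andP[tS hS] _].
  by split; apply: contraNneq xS => <-.
have charW v : v \in S' -> (W v : nat) = \sum_(w in S' | W w) (v == w).
  move=> vS'; case: (boolP (W v)) => Wv.
    rewrite (bigD1 v) /= ?vS' ?eqxx // big1 // => w /andP[_].
    by rewrite eq_sym => /negPf->.
  rewrite big1 // => w /andP[_ Ww]; case: eqP => // vw.
  by rewrite vw Ww in Wv.
have -> : odd (deg t h [set e in X | W (l e) (+) W (r e)] x) =
  odd (\sum_(e in X) ((t e == x) + (h e == x)) * (W (l e) + W (r e))).
  rewrite degE; under eq_bigl do rewrite inE.
  rewrite big_mkcondr /=; elim/big_rec2: _ => // e m n _ mn.
  rewrite !oddD oddM mn; case: (W _); case: (W _);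
    by rewrite /= ?oddD ?andbT ?andbF ?addbF ?addFb //= ?andbT ?andbF.
rewrite (eq_bigr (fun e => \sum_(w in S' | W w)
   ((t e == x) + (h e == x)) * ((l e == w) + (r e == w)))) => [|e eX].
  rewrite exchange_big /=; elim/big_rec: _ => // w n /andP[wS' _] nE.
  by rewrite oddD (negPf nE) addbF; apply: orth.
by case/andP: (lr_in e eX) => lS' rS'; rewrite -big_distrr big_split /= !charW.
Qed.

Local Open Scope ring_scope.

(** Converse of [cut_even]. Cuts are even by orthogonality alone; that nothing else is even is where
    the genus 0 enters, through [euler]. *)
Lemma even_cut (A : {set E}) : A \subset X ->
  (forall u, ~~ odd (deg t h A u)) ->
  exists W : pred V, {in X, forall e, (e \in A) = W (l e) (+) W (r e)}.
Proof.
move=> sAX evenA; case: dual_thlr => _ _ spS spS' orth eul.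
pose M := incidence X t h S; pose M' := incidence X l r S'.
have M'M0 : M' *m M^T = 0.
  apply/matrixP => i j; rewrite !mxE.
  under eq_bigr do rewrite !mxE -natrM.
  rewrite -natr_sum; apply/eqP; rewrite natF2_eq0.
  have := orth _ _ (enum_valP j) (enum_valP i).
  rewrite big_enum_val.
  by under eq_bigr do rewrite mulnC.
(* The cuts have dimension at least |S'| - 1. The even sets have dimension |X| - rank M, at most |X|
   - |S| + 1, and [euler] makes the two bounds equal. *)
have kerM : (kermx M^T <= M')%MS.
  have [le_rank <-] := mxrank_leqif_sup (introT sub_kermxP M'M0).
  rewrite eqn_leq le_rank mxrank_ker mxrank_tr.
  have := rank_incidence spS; have := rank_incidence spS'; rewrite -/M -/M'.
  have := rank_leq_col M; lia.
pose a : 'rV['F_2]_#|X| := \row_j (enum_val j \in A)%:R.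
have /submxP[w aE] : (a <= M')%MS.
  apply: submx_trans kerM; apply/sub_kermxP/rowP => i; rewrite !mxE.
  under eq_bigr do rewrite !mxE -natrM.
  rewrite -natr_sum; apply/eqP; rewrite natF2_eq0.
  have := evenA (enum_val i); rewrite degE.
  rewrite -(big_enum_val (fun e => (e \in A) *
    ((t e == enum_val i) + (h e == enum_val i)))%N) /=.
  rewrite [X in _ -> ~~ odd X](big_setID A) /= (setIidPr sAX).
  rewrite [X in (_ + X)%N]big1 => [|e].
    by rewrite addn0; under [X in _ -> ~~ odd X]eq_bigr => e -> do rewrite mul1n.
  by rewrite inE => /andP[/negPf->].
(* The coefficients [w] expressing the indicator of [A] by rows of [M'] are the indicator of one
   side of the cut. *)
exists (fun x => cochain w x != 0) => e eX.
move/rowP/(_ (enum_rank_in eX e)): aE.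
rewrite mul_incidence mxE !enum_rankK_in // => eE.
have F2E (x : 'F_2) : x = (x != 0)%:R.
  by apply/val_inj; case: x => [[|[|x]]].
apply: negb_inj; move: (natF2_eq0 (e \in A)); rewrite oddb eE => <-.
rewrite [cochain w (l e)]F2E [cochain w (r e)]F2E -natrD natF2_eq0.
by case: (cochain w (l e) == 0); case: (cochain w (r e) == 0).
Qed.

End DualPair.

Lemma addb_eq0P (a b : bool) : reflect (a = b) (~~ (a (+) b)).
Proof. by case: a b => [] []; constructor. Qed.

(** * Complements of spanning trees and sides of fundamental cycles *)

Section SpanningTree.
Variables (V E : finType) (t h l r : E -> V) (S S' : {set V}) (X T : {set E}).
Hypothesis dual_thlr : dual_pair t h l r S S' X.
Hypothesis sTX : T \subset X.

(** An even set of dual edges is a cut of the primal graph. It avoids [T], which spans, so both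
    sides cannot be occupied and the cut is empty. *)
Lemma dual_acyclic : spans t h S T -> acyclic l r (X :\: T).
Proof.
move=> spT; apply/even_acyclicP => B sB evenB; apply/setP => e; rewrite inE.
apply/negP => eB.
have sBX : B \subset X := subset_trans sB (subsetDl _ _).
have [W WE] := even_cut (dual_pairC dual_thlr) sBX evenB.
have WT : {in T, forall d, W (t d) = W (h d)}.
  move=> d dT; apply/addb_eq0P; rewrite -WE ?(subsetP sTX) //.
  by apply/negP => /(subsetP sB); rewrite inE dT.
have /andP[teS heS] := ends_in dual_thlr (subsetP sBX e eB).
have /addb_eq0P/negP[] :=
  adj_invariant WT (forall_inP (forall_inP spT _ teS) _ heS).
by rewrite -WE // (subsetP sBX).
Qed.

(** A component of the dual complement defines a cut contained in [T]. This cut is even, hence empty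
    by acyclicity, and the component is everything. *)
Lemma dual_spans : acyclic t h T -> spans l r S' (X :\: T).
Proof.
move=> acT; apply/forall_inP => u uS; apply/forall_inP => v vS.
pose W := connect (adj l r (X :\: T)) u.
have WE : [set e in X | W (l e) (+) W (r e)] = set0.
  apply: (acyclic_even acT); last by move=> x; apply: (cut_even dual_thlr).
  apply/subsetP => e; rewrite inE => /andP[eX]; apply: contraLR => eT.
  apply/addb_eq0P; rewrite /W !(connect_adj_sym _ _ _ u).
  apply/same_connect/connect1/adj_end; first exact: connect_adj_sym.
  by rewrite inE eT.
have uv := forall_inP (forall_inP (dual_pair_dual_spans dual_thlr) _ uS) _ vS.
rewrite -[connect _ u v]/(W v) -(adj_invariant (f := W) _ uv) ?/W ?connect0 //.
move=> e eX; apply/addb_eq0P/negP => We.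
by move/setP/(_ e): WE; rewrite inE eX We inE.
Qed.

(** The graph outside [C] has more edges, so only one direction has content. If [q] reached [l e]
    outside [C] but not in the dual tree without [e], it would reach [r e] there. Then both sides of
    [e] would lie on the same side of [C], although [e] belongs to [C]. *)
Lemma connect_cycle_side (C : {set E}) e q :
  spans t h S T -> acyclic t h T -> e \in X :\: T -> q \in S' ->
  C \subset e |: T -> cyc t h C ->
  connect (adj l r (X :\: C)) q (l e) =
  connect (adj l r (X :\: (e |: T))) q (l e).
Proof.
move=> spT acT; rewrite inE => /andP[eT eX] qS sC cycC.
have sCX : C \subset X by rewrite (subset_trans sC) // subUset sub1set eX.
have [W WE] := even_cut dual_thlr sCX (fun u => cyc_even u cycC).
have Winv x y : connect (adj l r (X :\: C)) x y -> W x = W y.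
  apply: adj_invariant => d; rewrite inE => /andP[dC dX].
  by apply/addb_eq0P; rewrite -WE.
have sub : subrel (connect (adj l r (X :\: (e |: T))))
                  (connect (adj l r (X :\: C))).
  by apply: sub_adj; apply: setDS.
apply/idP/idP; last exact: sub.
move=> qC; have /andP[leS _] := dual_ends_in dual_thlr eX.
have := @acyclic_ends _ _ l r S' (X :\: T) e q (dual_spans acT)
  (dual_acyclic spT).
rewrite setDDl [T :|: _]setUC inE eT eX => /(_ isT qS leS).
case: (connect _ q (l e)) => //= /(sub q (r e)) qr.
have eC : e \in C.
  apply: contraT => eC; have /eqP[] := cyc_neq0 cycC.
  apply: (acyclic_even acT) => [|u]; last exact: cyc_even.
  apply/subsetP => d dC; have /setU1P[de|//] := subsetP sC d dC.
  by rewrite -de dC in eC.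
by have := WE e eX; rewrite eC -(Winv _ _ qC) -(Winv _ _ qr) addbb.
Qed.

End SpanningTree.

(** * The Tait digraph of a connected diagram *)

Lemma even_free_involution (T : finType) (f : T -> T) (A : {set T}) :
  {in A, involutive f} -> {in A, forall x, f x != x} ->
  {homo f : x / x \in A} -> ~~ odd #|A|.
Proof.
have [n] := ubnP #|A|; elim: n A => // n IH A ltAn fK f_neq fA.
have [-> | [x xA]] := set_0Vmem A; first by rewrite cards0.
have fxA : f x \in A :\ x by rewrite !inE f_neq ?fA.
have sA : {subset A :\ x :\ f x <= A} by move=> y; rewrite !inE => /and3P[].
move: ltAn; rewrite (cardsD1 x) xA (cardsD1 (f x)) fxA /= negbK => ltAn.
apply: IH => [|y /sA|y /sA|y]; [by lia | exact: fK | exact: f_neq |].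
rewrite !inE => /and3P[yfx yx yA]; rewrite fA // andbT.
apply/andP; split; last by apply: contraNneq yfx => <-; rewrite fK.
by apply: contraNneq yx => fyx; rewrite -(fK y yA) fyx fK.
Qed.

Lemma porbit_sub (T : finType) (s : {perm T}) x (A : {set T}) :
  x \in A -> {homo s : y / y \in A} -> porbit s x \subset A.
Proof.
move=> xA sA; apply/subsetP => y /porbitP[i ->].
by rewrite permX; elim: i => //= i; apply: sA.
Qed.

Lemma mem_porbit_perm (T : finType) (s : {perm T}) x y :
  y \in porbit s x -> s y \in porbit s x.
Proof.
by case/porbitP=> i ->; apply/porbitP; exists i.+1; rewrite expgSr permM.
Qed.

Lemma card_porbits_sum (T : finType) (s : {perm T}) (A : {set T}) :
  #|A| = \sum_(B in porbits s) #|A :&: B|.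
Proof.
rewrite -sum1_card (partition_big (porbit s) [in porbits s]) => [|x _].
  apply: eq_bigr => _ /imsetP[x _ ->]; rewrite -sum1_card.
  by apply: eq_bigl => y; rewrite inE eq_porbit_mem.
exact: imset_f.
Qed.

Section Diagram.
Variable D : diagram.
Implicit Types d : dart D.

Lemma crossing_node d : crossing (node d) = crossing d.
Proof. by rewrite /crossing /crossing_of (inj_eq perm_inj). Qed.

Lemma node_plain d : ~~ crossing d -> node (node d) = d.
Proof. by rewrite /crossing /crossing_of negbK => /eqP. Qed.

Lemma over_crossing_node d : crossing d -> over (node d) = ~~ over d.
Proof. exact: over_node. Qed.

Lemma out_node2 d : crossing d -> out (node (node d)) = ~~ out d.
Proof. by move=> cd; rewrite -out_opposite /opposite_of -/(crossing d) cd. Qed.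

Lemma out_plain d : ~~ crossing d -> out (node d) = ~~ out d.
Proof.
by move=> cd; rewrite -out_opposite /opposite_of -/(crossing d) (negPf cd).
Qed.

Lemma edge_neq d : edge d != d.
Proof. by apply/eqP => ed; have := out_edge d; rewrite ed; case: out. Qed.

Lemma region_face d : region (face D d) = region d.
Proof. exact: (porbit_perm (face D) 1 d). Qed.

Lemma region_edge_node d : region (edge (node d)) = region d.
Proof. by rewrite -region_face /face /face_of !permE /= edge2 permK. Qed.

Lemma porbit_edge d : #|porbit edge d| = 2.
Proof.
suff -> : porbit edge d = [set d; edge d] by rewrite cards2 eq_sym edge_neq.
apply/eqP; rewrite eqEsubset porbit_sub ?inE ?eqxx //=; last first.
  by move=> x /set2P[]->; rewrite ?edge2 !inE eqxx ?orbT.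
by rewrite subUset !sub1set mem_porbit_perm porbit_id.
Qed.

Lemma porbit_plain d : ~~ crossing d -> porbit node d = [set d; node d].
Proof.
move=> cd; apply/eqP; rewrite eqEsubset porbit_sub ?inE ?eqxx //=; last first.
  by move=> x /set2P[]->; rewrite ?node_plain // !inE eqxx ?orbT.
by rewrite subUset !sub1set mem_porbit_perm porbit_id.
Qed.

Lemma porbit_crossing d :
  porbit node d = [set d; node d; node (node d); node (node (node d))].
Proof.
apply/eqP; rewrite eqEsubset porbit_sub ?inE ?eqxx //=; last first.
  move=> x; rewrite !inE -!orbA.
  by case/or4P=> /eqP->; rewrite ?node4 eqxx ?orbT.
by rewrite !subUset !sub1set -!andbA; apply/and4P; split;
  do ?apply: mem_porbit_perm; apply: porbit_id.
Qed.

Lemma sum_porbit_crossing d (F : dart D -> nat) : crossing d ->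
  \sum_(x in porbit node d) F x =
  F d + F (node d) + F (node (node d)) + F (node (node (node d))).
Proof.
move=> cd; have n3 : node (node (node d)) != d.
  by apply: contraNneq (node_neq d) => {1}<-; rewrite node4.
have n1 : d != node d by rewrite eq_sym node_neq.
have n2 : d != node (node d) by rewrite eq_sym.
have := n3; rewrite eq_sym => n3'; rewrite porbit_crossing -!setUA.
rewrite !big_setU1 ?big_set1 ?inE ?(inj_eq perm_inj) ?negb_or ?n1 ?n2 ?n3' //.
by rewrite /= !addnA.
Qed.

Lemma card_porbit_crossing d : crossing d -> #|porbit node d| = 4.
Proof. by move=> cd; rewrite -sum1_card sum_porbit_crossing. Qed.

(** The dart by which the Tait digraph represents the crossing of [d], computed from any of its four
    darts. Used in [mirror D], it selects the outgoing end of the former understrand. *)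
Definition overstrand_out d : dart D :=
  if over d then if out d then d else node (node d)
  else if out (node d) then node d else node (node (node d)).

Lemma porbit_tait_edges d : crossing d ->
  porbit node d :&: tait_edges D = [set overstrand_out d].
Proof.
move=> cd; apply/setP => x.
have [c1 [c2 c3]] : crossing (node d) /\ crossing (node (node d)) /\
  crossing (node (node (node d))) by rewrite !crossing_node.
have o1 := over_crossing_node cd; have o2 := over_crossing_node c1.
have o3 := over_crossing_node c2.
have u2 := out_node2 cd; have u3 := out_node2 c1.
rewrite porbit_crossing !inE /overstrand_out -!orbA; apply/andP/eqP.
  case=> /or4P[]/eqP->; rewrite ?o3 ?o2 ?o1 ?u2 ?u3 => /and3P[_].
  - by move=> -> ->.
  - by move=> /negPf-> ->.
  - by rewrite negbK => -> /negPf->.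
  by rewrite negbK => /negPf-> /negPf->.
case od : (over d); [case ud: (out d)|case ud: (out (node d))] => ->;
  by rewrite ?eqxx ?orbT ?cd ?c1 ?c2 ?c3 ?o3 ?o2 ?o1 ?u2 ?u3 ?od ?ud.
Qed.

(** The formula covers both kinds of nodes, 4 = 2 + 2 and 2 = 2 + 0, so that plain points cancel in
    Euler's formula. *)
Lemma card_porbit_node d :
  #|porbit node d| = 2 + 2 * #|tait_edges D :&: porbit node d|.
Proof.
have [cd | cd] := boolP (crossing d).
  by rewrite card_porbit_crossing // setIC porbit_tait_edges // cards1.
rewrite porbit_plain // cards2 eq_sym node_neq.
suff -> : tait_edges D :&: [set d; node d] = set0 by rewrite cards0.
apply/setP => x; rewrite !inE; apply/negP => /andP[/and3P[cx _ _]].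
by case/orP=> /eqP xE; move: cx; rewrite xE ?crossing_node (negPf cd).
Qed.

(** With n nodes, c of them crossings, there are 2n + 2c darts and n + c arcs; Euler's formula
    leaves c + 2 regions. *)
Lemma card_faces : connected D -> #|porbits (face D)| = #|tait_edges D| + 2.
Proof.
move=> /eqP connD.
have := @planar D; rewrite /planar_map connD -/(face D) => /eqP.
have := card_porbits_sum (@node D) [set: dart D].
rewrite (eq_bigr (fun B => 2 + 2 * #|tait_edges D :&: B|)); last first.
  by move=> _ /imsetP[d _ ->]; rewrite setTI card_porbit_node.
have := card_porbits_sum (@edge D) [set: dart D].
rewrite (eq_bigr (fun=> 2)); last first.
  by move=> _ /imsetP[d _ ->]; rewrite setTI porbit_edge.
rewrite big_split -big_distrr /= -card_porbits_sum !sum_nat_const cardsT.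
move: #|porbits edge| #|porbits node| #|porbits (face D)|.
move: #|tait_edges D| #|dart D|.
lia.
Qed.

Lemma connect_link_sym : connect_sym (link_of (@node D) edge).
Proof.
have back x y : link_of (@node D) edge x y ->
    connect (link_of (@node D) edge) y x.
  have step z : connect (link_of (@node D) edge) z (node z).
    by apply: connect1; rewrite /link_of /= eqxx.
  case/orP=> /eqP->; last by apply: connect1; rewrite /link_of /= edge2 eqxx orbT.
  (* Three further turns around the node lead from [node x] back to [x]. *)
  rewrite -{2}(node4 x); do 2!apply: connect_trans (step _) _; exact: step.
suff imp x y : connect (link_of (@node D) edge) x y ->
    connect (link_of (@node D) edge) y x by move=> x y; apply/idP/idP; exact: imp.
case/connectP=> p; elim: p x => [|z p IHp] x /=; first by move=> _ ->.
case/andP=> xz zp yE; exact: connect_trans (IHp z zp yE) (back _ _ xz).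
Qed.

Lemma connected_connect x y :
  connected D -> connect (link_of (@node D) edge) x y.
Proof.
move=> /eqP connD; rewrite -(root_connect connect_link_sym).
have /card_le1_eqP le1 :
    #|[predI roots (link_of (@node D) edge) & dart D]| <= 1.
  by rewrite -/(n_comp _ _) connD.
by apply/eqP/le1; rewrite inE andbT; apply: (roots_root connect_link_sym).
Qed.

Lemma connected_spans (V : finType) (R : rel V) (f : dart D -> V) :
  connected D -> (forall d, connect R (f d) (f (edge d))) ->
  (forall d, connect R (f d) (f (node d))) ->
  forall x y, connect R (f x) (f y).
Proof.
move=> connD f_edge f_node x y.
have /connectP[p] := connected_connect x y connD.
elim: p x => [|z p IHp] x /=; first by move=> _ ->.
case/andP=> xz zp yE; apply: connect_trans (IHp z zp yE).
by case/orP: xz => /eqP ->.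
Qed.

(** Exactly one of the two regions beside a dart has the colour [Y]. Moving along [edge] or [node]
    keeps this region, except that turning at a crossing may replace it by the opposite corner.
    Stating this for one colour class covers both the Tait digraph and its dual. *)
Lemma spans_colour (Y : {set {set dart D}}) (E : finType)
    (a b : E -> {set dart D}) (A : {set E}) :
  connected D -> Y \subset porbits (face D) ->
  (forall d, (region (edge d) \in Y) = (region d \notin Y)) ->
  (forall d, crossing d -> region d \in Y ->
     connect (adj a b A) (region d) (region (node (node d)))) ->
  spans a b Y A.
Proof.
move=> connD sY Y_edge Y_cross.
pose sh d := if region d \in Y then region d else region (edge d).
suff conn x y : connect (adj a b A) (sh x) (sh y).
  apply/forall_inP => u uY; apply/forall_inP => v vY.
  have /imsetP[x _ ux] := subsetP sY u uY.
  have /imsetP[y _ vy] := subsetP sY v vY.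
  by have := conn x y; rewrite /sh /region -ux -vy uY vY.
apply: connected_spans => // d; rewrite /sh.
  by rewrite Y_edge edge2; case: (region d \in Y).
have Y_node : (region (node d) \in Y) = (region d \notin Y).
  by rewrite -(region_edge_node d) Y_edge negbK.
rewrite Y_node; case: ifP => dY /=; first by rewrite region_edge_node.
have [cd | cd] := boolP (crossing d); last first.
  by rewrite -{1}(node_plain cd) region_edge_node.
have := Y_cross (node (node (node d))).
rewrite !crossing_node -{1 2}region_edge_node node4 Y_edge dY => /(_ cd isT).
by [].
Qed.

Lemma overstrand_outE d : crossing d ->
  overstrand_out d \in tait_edges D.
Proof.
move=> /porbit_tait_edges/setP/(_ (overstrand_out d)).
by rewrite !inE eqxx => /andP[].
Qed.

Section Shading.
Variable S : {set {set dart D}}.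
Hypothesis shS : tait_shading S.
Let S' := porbits (face D) :\: S.

Lemma region_edge d : (region (edge d) \in S) = (region d \notin S).
Proof. by case: shS. Qed.

Lemma region_node d : (region (node d) \in S) = (region d \notin S).
Proof. by rewrite -(region_edge_node d) region_edge negbK. Qed.

Lemma region_over d : crossing d -> (region d \in S) = over d.
Proof.
case: shS => _ _ shade cd; apply/idP/idP; last exact: shade.
apply: contraTT => ud; rewrite -region_node shade ?crossing_node //.
by rewrite over_crossing_node.
Qed.

Lemma region_in_compl d : (region d \in S') = (region d \notin S).
Proof. by rewrite inE imset_f ?andbT. Qed.

Lemma compl_shading : tait_shading (D := mirror D) S'.
Proof.
split=> [|d|d]; first exact: subsetDl.
  by rewrite !region_in_compl region_edge.
move=> cd ud; rewrite region_in_compl.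
by rewrite (region_over cd).
Qed.

Hypothesis connD : connected D.

Lemma tait_edgesP d :
  reflect [/\ crossing d, over d & out d] (d \in tait_edges D).
Proof. by rewrite inE; apply: and3P. Qed.

Lemma tait_ends d : d \in tait_edges D -> (tail d \in S) && (head d \in S).
Proof.
case/tait_edgesP=> cd od _.
by rewrite /tail /head !region_node negbK region_over // od.
Qed.

Lemma tait_sides d :
  d \in tait_edges D -> (left_face d \in S') && (right_face d \in S').
Proof.
case/tait_edgesP=> cd od _; rewrite /left_face /right_face !region_in_compl.
by rewrite !region_node !negbK region_over // od.
Qed.

Lemma tait_spans : spans (@tail D) (@head D) S (tait_edges D).
Proof.
case: (shS) => sS S_edge _; apply: spans_colour => // d cd.
rewrite region_over // => od; have := overstrand_outE cd.
move/(adj_end (@tail D) (@head D))/connect1.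
rewrite /overstrand_out od /tail /head; case: (out d); last by rewrite node4.
by rewrite connect_adj_sym.
Qed.

Lemma tait_dual_spans :
  spans (@left_face D) (@right_face D) S' (tait_edges D).
Proof.
case: (shS) => sS S_edge _; apply: spans_colour => // [|d|d cd].
- exact: subsetDl.
- by rewrite !region_in_compl S_edge.
rewrite region_in_compl region_over // => od; have := overstrand_outE cd.
move/(adj_end (@left_face D) (@right_face D))/connect1.
rewrite /overstrand_out (negPf od) /left_face /right_face.
case: (out (node d)); rewrite !node4 //.
by rewrite connect_adj_sym.
Qed.

(* The sum counts, modulo 2, the darts at crossings which separate u from v.
   Both the darts separating u from v and those among them at plain points
   are paired off, by edge and by node. *)
Lemma tait_orthogonal : {in S & S', forall u v,
  ~~ odd (\sum_(e in tait_edges D) ((tail e == u) + (head e == u)) *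
                         ((left_face e == v) + (right_face e == v)))}.
Proof.
move=> u v uS; rewrite inE => /andP[vS _].
pose sep d := ((region d == u) && (region (edge d) == v)) ||
              ((region d == v) && (region (edge d) == u)).
have sep_edge d : sep (edge d) = sep d.
  by rewrite /sep edge2 orbC andbC [X in _ || X]andbC.
have sep_node d : ~~ crossing d -> sep (node d) = sep d.
  move=> cd; have dn : region (edge d) = region (node d).
    by rewrite -{1}(node_plain cd) region_edge_node.
  by rewrite /sep region_edge_node dn orbC andbC [X in _ || X]andbC.
pose A := [set d | sep d].
have evenA : ~~ odd #|A|.
  apply: (@even_free_involution _ edge) => [d _|d _|d].
  - exact: edge2.
  - exact: edge_neq.
  by rewrite !inE sep_edge.
pose Q := [set d : dart D | ~~ crossing d].
have evenP : ~~ odd #|A :&: Q|.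
  apply: (@even_free_involution _ node) => [d|d _|d].
  - by rewrite !inE => /andP[_ /node_plain].
  - exact: node_neq.
  by rewrite !inE crossing_node => /andP[? cd]; rewrite sep_node // cd andbT.
suff <- : #|A :\: Q| =
    \sum_(e in tait_edges D) ((tail e == u) + (head e == u)) *
                             ((left_face e == v) + (right_face e == v)).
  by move: evenA; rewrite -(cardsID Q A) oddD (negPf evenP).
(* Group the darts by crossing. The four darts of a crossing separate consecutive corners, and these
   pairs of corners are the four terms of the product of (tail + head) and (left + right). *)
rewrite -sum1_card (partition_big overstrand_out [in tait_edges D]) /=;
  last by move=> d /setDP[_]; rewrite [d \in Q]inE negbK => /overstrand_outE.
apply: eq_bigr => e eX; have /tait_edgesP[ce oe _] := eX.
have fibre d : crossing d && (overstrand_out d == e) = (d \in porbit node e).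
  rewrite porbit_sym; case: (boolP (crossing d)) => cd /=.
    have /setP/(_ e) := porbit_tait_edges cd.
    by rewrite in_setI eX andbT in_set1 eq_sym.
  rewrite porbit_plain // !inE; apply/esym/negbTE.
  apply: contraNN cd => /orP[]/eqP eE; first by rewrite -eE.
  by rewrite -(crossing_node d) -eE.
rewrite (eq_bigl (fun d => (d \in porbit node e) && sep d)) => [|d]; last first.
  by rewrite in_setD [d \in Q]inE [d \in A]inE negbK -fibre andbAC.
rewrite big_mkcondr sum_porbit_crossing //= /sep !region_edge_node.
have -> : region (edge e) = right_face e.
  by rewrite -{1}(node4 e) region_edge_node.
rewrite -/(tail e) -/(left_face e) -/(right_face e) -/(head e).
have /andP[tS hS] := tait_ends eX.
have /andP[] := tait_sides eX; rewrite !inE => /andP[lS _] /andP[rS _].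
have neq a b : a \in S -> b \notin S -> ((a == b) = false) * ((b == a) = false).
  by move=> aS bS; rewrite [b == a]eq_sym; split; apply: contraNF bS => /eqP<-.
rewrite !(neq _ _ tS vS) !(neq _ _ hS vS) !(neq _ _ uS lS) !(neq _ _ uS rS).
rewrite !(andbF, andFb, orbF).
by case: (tail e == u); case: (head e == u); case: (left_face e == v);
  case: (right_face e == v).
Qed.

Lemma tait_dual_pair : dual_pair (@tail D) (@head D) (@left_face D)
  (@right_face D) S S' (tait_edges D).
Proof.
split; [exact: tait_ends | exact: tait_sides | exact: tait_spans
  | exact: tait_dual_spans | exact: tait_orthogonal |].
case: shS => sS _ _; rewrite -card_faces // cardsD (setIidPr sS) addnC subnK //.
exact: subset_leq_card.
Qed.

Lemma spanning_treeE (T : {set dart D}) : spanning_tree S T =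
  [&& T \subset tait_edges D, spans (@tail D) (@head D) S T
    & acyclic (@tail D) (@head D) T].
Proof. by []. Qed.

Lemma int_semi_active_head (r : {set dart D}) T e :
  spanning_tree S T -> r \in S -> e \in T ->
  connect (vadj (T :\ e)) r (head e) = ~~ int_semi_active r T e.
Proof.
rewrite spanning_treeE => /and3P[sTX spT acT] rS eT.
apply: (acyclic_ends spT) => //.
by have /andP[] := tait_ends (subsetP sTX e eT).
Qed.

(** Removes [Cyc]: external activity takes the shape of [int_semi_active], for the dual tree rooted
    at [q]. *)
Lemma ext_semi_activeE (q : {set dart D}) T e :
  spanning_tree S T -> q \in S' -> e \in tait_edges D :\: T ->
  ext_semi_active q T e = connect (fadj (e |: T)) q (left_face e).
Proof.
rewrite spanning_treeE => /and3P[sTX spT acT] qS eXT.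
have := eXT; rewrite inE => /andP[eT eX].
rewrite /ext_semi_active /Cyc; case: pickP => [C /andP[sC cycC] | noC] /=.
  exact: (connect_cycle_side tait_dual_pair).
have /andP[teS heS] := tait_ends eX.
have [C sC cycC] := spans_cyc spT eT teS heS.
by have := noC C; rewrite sC => /negP[].
Qed.

Lemma ext_semi_active_right (q : {set dart D}) T e :
  spanning_tree S T -> q \in S' -> e \in tait_edges D :\: T ->
  connect (fadj (e |: T)) q (right_face e) = ~~ ext_semi_active q T e.
Proof.
move=> spTT qS eXT; rewrite ext_semi_activeE //.
have := spTT; rewrite spanning_treeE => /and3P[sTX spT acT].
have dualP := tait_dual_pair; have := eXT; rewrite inE => /andP[eT eX].
have := acyclic_ends (dual_spans dualP acT) (dual_acyclic dualP sTX spT) eXT qS.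
rewrite setDDl [T :|: _]setUC; apply.
by have /andP[] := tait_sides eX.
Qed.

Lemma dual_tree (T : {set dart D}) : T \subset tait_edges D ->
  spanning_tree S T =
  spans (@left_face D) (@right_face D) S' (tait_edges D :\: T) &&
  acyclic (@left_face D) (@right_face D) (tait_edges D :\: T).
Proof.
move=> sTX; have dualP := tait_dual_pair; rewrite spanning_treeE sTX /=.
have sTX' : tait_edges D :\: T \subset tait_edges D := subsetDl _ _.
have TE : tait_edges D :\: (tait_edges D :\: T) = T.
  by rewrite setDDr setDv set0U (setIidPr sTX).
apply/andP/andP=> -[spT acT].
  by rewrite (dual_spans dualP) ?(dual_acyclic dualP).
rewrite -{1 2}TE; split.
  exact: (dual_spans (dual_pairC dualP)).
exact: (dual_acyclic (dual_pairC dualP)).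
Qed.

End Shading.
End Diagram.

(** * Reversal and mirror image *)

Lemma card_imset_cond (E E' : finType) (X A : {set E}) (f : E -> E')
    (p : pred E) (p' : pred E') :
  {in X &, injective f} -> A \subset X -> {in A, forall e, p' (f e) = p e} ->
  #|[set e in f @: A | p' e]| = #|[set e in A | p e]|.
Proof.
move=> f_inj /subsetP sAX pE; rewrite -(@card_in_imset _ _ f [set e in A | p e]).
  congr #|pred_of_set _|; apply/setP => y; apply/idP/idP.
    rewrite inE => /andP[/imsetP[e eA ->]]; rewrite pE // => pe.
    by apply: imset_f; rewrite inE eA.
  case/imsetP=> e; rewrite inE => /andP[eA pe] ->.
  by rewrite inE imset_f // pE.
move=> x y; rewrite !inE => /andP[xA _] /andP[yA _].
by apply: f_inj; apply: sAX.
Qed.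

Lemma imsetD_in (E E' : finType) (X A B : {set E}) (f : E -> E') :
  {in X &, injective f} -> A \subset X -> B \subset X ->
  f @: (A :\: B) = f @: A :\: f @: B.
Proof.
move=> f_inj /subsetP sAX /subsetP sBX; apply/setP => y; rewrite inE.
apply/imsetP/andP => [[x /setDP[xA xB] ->]|[yB /imsetP[x xA yx]]].
  split; last exact: imset_f.
  apply: contraNN xB => /imsetP[x' x'B fx].
  by rewrite (f_inj _ _ (sAX _ xA) (sBX _ x'B) fx).
exists x; rewrite // inE xA andbT; apply: contraNN yB => xB.
by rewrite yx imset_f.
Qed.

Local Open Scope ring_scope.

(** Since [f] is injective only on [X], the inverse of the image map is the preimage intersected
    with [X]. *)
Lemma sum_imset (M : nmodType) (E E' : finType) (X : {set E}) (f : E -> E')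
    (p : pred {set E}) (p' : pred {set E'}) (F : {set E'} -> M) :
  {in X &, injective f} -> (forall T : {set E}, p T -> T \subset X) ->
  (forall T : {set E'}, p' T -> T \subset f @: X) ->
  (forall T : {set E}, T \subset X -> p' (f @: T) = p T) ->
  \sum_(T | p' T) F T = \sum_(T | p T) F (f @: T).
Proof.
move=> f_inj pX pX' pE.
pose g (T : {set E'}) := [set e in X | f e \in T].
have sgX T : g T \subset X by apply/subsetP => e; rewrite inE => /andP[].
rewrite (reindex_onto (fun T : {set E} => f @: T) g) => [|T /pX'/subsetP sT].
  apply: eq_bigl => T; have [sTX | nsTX] := boolP (T \subset X); last first.
    have -> : p T = false by apply: contraNF nsTX => /pX.
    by apply: contraNF nsTX => /andP[_ /eqP<-].
  rewrite pE // (_ : g _ == T) ?andbT //; apply/eqP/setP => e; rewrite inE.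
  apply/andP/idP => [[eX /imsetP[x xT fe]]|eT].
    by rewrite (f_inj _ _ eX (subsetP sTX _ xT) fe).
  by rewrite (subsetP sTX) // imset_f.
apply/setP=> y; apply/imsetP/idP => [[x]|yT]; first by rewrite inE => /andP[_ ?] ->.
have /imsetP[x xX yx] := sT y yT.
by exists x; rewrite // inE xX -yx.
Qed.

Lemma sum_compl (M : nmodType) (E : finType) (X : {set E}) (p : pred {set E})
    (F : {set E} -> M) : (forall T : {set E}, p T -> T \subset X) ->
  \sum_(T | p T) F T =
  \sum_(T : {set E} | (T \subset X) && p (X :\: T)) F (X :\: T).
Proof.
move=> pX; rewrite (reindex_onto (fun T : {set E} => X :\: T) (fun T => X :\: T)).
  apply: eq_bigl => T; rewrite andbC; congr (_ && _).
  rewrite setDDr setDv set0U; apply/eqP/idP => [<-|]; first exact: subsetIl.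
  by move/setIidPr.
by move=> T /pX/setIidPr; rewrite setDDr setDv set0U.
Qed.

Section TreeSum.
Variables (D : diagram) (S : {set {set dart D}}) (r q : {set dart D}).
Variable (R : comPzRingType).

(** All four variables enter with nonnegative exponents, so both symmetries become permutations of
    the arguments, valid without any inverse. *)
Definition tree_sum (a b c d : R) : R :=
  \sum_(T : {set dart D} | spanning_tree S T)
    a ^+ iota_pos r T * b ^+ iota_bar_pos r T * c ^+ eps_neg q T *
    d ^+ eps_bar_neg q T.

End TreeSum.

Lemma laurent_eval_tree (R : comUnitRingType) (D : diagram)
    (S : {set {set dart D}}) (r q : {set dart D}) (x y z w : R) :
  laurent_eval (tree_polynomial S r q) x y z w =
  tree_sum S r q x^-1 y^-1 z w.
Proof.
pose f : {rmorphism int -> R} := intmul 1.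
pose v := tnth [tuple x^-1; y^-1; z; w].
pose g : {rmorphism {mpoly int[4]} -> R} := mmap f v.
have gX i : g 'X_i = v i by rewrite /g /= mmapX mmap1U.
rewrite -[LHS]/(g _) rmorph_sum; apply: eq_bigr => T _.
by rewrite !rmorphM !rmorphXn /= !gX /v !(tnth_nth 0) !inordK.
Qed.

Section ReverseMirror.
Variables (D : diagram) (S : {set {set dart D}}) (r q : {set dart D}).
Let S' := porbits (face D) :\: S.
Hypothesis connD : connected D.
Hypothesis shS : tait_shading S.
Hypothesis rS : r \in S.
Hypothesis qS' : q \in S'.
Local Notation X := (tait_edges D).
Implicit Types (d e : dart D) (T : {set dart D}).

(** After reversal the overstrand leaves its crossing at the other end. The type makes [tail],
    [left_face] and [positive] of an image refer to the reversed diagram. *)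
Let node2 d : dart (reverse D) := node (node d).

Lemma node2_inj : {in X &, injective node2}.
Proof. by move=> d e _ _ /perm_inj/perm_inj. Qed.

Lemma reverse_ends : {in X, forall e,
  (tail (node2 e) = tail e /\ head (node2 e) = head e) \/
  (tail (node2 e) = head e /\ head (node2 e) = tail e)}.
Proof. by move=> e _; right; split=> //; rewrite /tail /node2 node4. Qed.

Lemma reverse_sides : {in X, forall e,
  (left_face (node2 e) = left_face e /\ right_face (node2 e) = right_face e) \/
  (left_face (node2 e) = right_face e /\ right_face (node2 e) = left_face e)}.
Proof. by move=> e _; right; split=> //; rewrite /right_face /node2 node4. Qed.

Lemma reverse_tait_edges : tait_edges (reverse D) = node2 @: X.
Proof.
apply/setP => d; apply/tait_edgesP/imsetP => [[cd od ud]|[e eX ->]].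
  exists (node2 d); last by rewrite /node2 node4.
  apply/tait_edgesP; rewrite /node2 !crossing_node !over_crossing_node ?crossing_node //.
  by rewrite negbK out_node2.
have /tait_edgesP[ce oe ue] := eX.
split; first by rewrite -[crossing _]/(@crossing D (node (node e))) !crossing_node.
  by rewrite -[over _]/(@over D (node (node e))) !over_crossing_node ?crossing_node ?oe.
by rewrite -[out _]/(~~ @out D (node (node e))) out_node2 // negbK.
Qed.

Lemma reverse_positive e : e \in X -> positive (node2 e) = positive e.
Proof.
case/tait_edgesP=> ce _ _.
by rewrite /positive -[LHS]/(~~ @out D (node (node (node e)))) out_node2
  ?crossing_node // negbK.
Qed.

Lemma reverse_spanning_tree T : T \subset X ->
  spanning_tree (D := reverse D) S (node2 @: T) = spanning_tree S T.
Proof.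
move=> sTX; rewrite !spanning_treeE reverse_tait_edges sTX imsetS //=.
by rewrite (spans_imset reverse_ends) // (acyclic_imset node2_inj reverse_ends).
Qed.

(** The tail of the reversed edge is the old head, which the root reaches exactly when it does not
    reach the old tail. *)
Lemma reverse_int_semi_active T e : spanning_tree S T -> e \in T ->
  int_semi_active (D := reverse D) r (node2 @: T) (node2 e) =
  ~~ int_semi_active r T e.
Proof.
move=> spT eT; have := spT; rewrite spanning_treeE => /and3P[sTX _ _].
rewrite -(int_semi_active_head shS) //.
rewrite -[RHS](connect_adj_imset reverse_ends);
  last exact: subset_trans (subsetDl _ _) sTX.
rewrite (imsetD_in node2_inj) ?sub1set ?(subsetP sTX) // imset_set1.
by rewrite /int_semi_active /tail /node2 node4.
Qed.

Lemma reverse_ext_semi_active T e : spanning_tree S T -> e \in X :\: T ->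
  ext_semi_active (D := reverse D) q (node2 @: T) (node2 e) =
  ~~ ext_semi_active q T e.
Proof.
move=> spT eXT; have := spT; rewrite spanning_treeE => /and3P[sTX _ _].
have /setDP[eX eT] := eXT.
have spT' : spanning_tree (D := reverse D) S (node2 @: T).
  by rewrite reverse_spanning_tree.
have eXT' : node2 e \in tait_edges (reverse D) :\: node2 @: T.
  by rewrite reverse_tait_edges -(imsetD_in node2_inj) // imset_f.
rewrite (@ext_semi_activeE (reverse D) S) //.
rewrite -(ext_semi_active_right shS) //.
rewrite -[RHS](connect_adj_imset reverse_sides (A := X :\: (e |: T))) ?subsetDl //.
rewrite (imsetD_in node2_inj) // ?subUset ?sub1set ?eX // imsetU1.
by rewrite -reverse_tait_edges.
Qed.

Lemma tree_sum_reverse (R : comPzRingType) (a b c d : R) :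
  tree_sum (D := reverse D) S r q a b c d = tree_sum S r q b a d c.
Proof.
rewrite /tree_sum (sum_imset _ node2_inj (p := spanning_tree S)); first last.
- exact: reverse_spanning_tree.
- by move=> T; rewrite spanning_treeE reverse_tait_edges => /and3P[].
- by move=> T; rewrite spanning_treeE => /and3P[].
apply: eq_bigr => T spT; have := spT; rewrite spanning_treeE => /and3P[sTX _ _].
have sXT : X :\: T \subset X := subsetDl _ _.
have -> : iota_pos (D := reverse D) r (node2 @: T) = iota_bar_pos r T.
  apply: (card_imset_cond node2_inj) => // e eT.
  by rewrite reverse_positive ?(subsetP sTX) // reverse_int_semi_active.
have -> : iota_bar_pos (D := reverse D) r (node2 @: T) = iota_pos r T.
  apply: (card_imset_cond node2_inj) => // e eT.
  by rewrite reverse_positive ?(subsetP sTX) // reverse_int_semi_active // negbK.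
rewrite /eps_neg /eps_bar_neg reverse_tait_edges -(imsetD_in node2_inj) //.
have -> : #|[set e in node2 @: (X :\: T) | ~~ positive e &&
    ext_semi_active (D := reverse D) q (node2 @: T) e]| = eps_bar_neg q T.
  apply: (card_imset_cond node2_inj) => // e eXT.
  by rewrite reverse_positive ?(subsetP sXT) // reverse_ext_semi_active.
have -> : #|[set e in node2 @: (X :\: T) | ~~ positive e &&
    ~~ ext_semi_active (D := reverse D) q (node2 @: T) e]| = eps_neg q T.
  apply: (card_imset_cond node2_inj) => // e eXT.
  by rewrite reverse_positive ?(subsetP sXT) // reverse_ext_semi_active // negbK.
by rewrite [a ^+ _ * _]mulrC -!mulrA [c ^+ _ * _]mulrC.
Qed.

(** On a Tait edge of [D] this gives the dual edge: it passes through the same crossing, along the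
    strand that lies on top after the switch. *)
Let under d : dart (mirror D) := @overstrand_out (mirror D) d.

Lemma underE e : e \in X ->
  under e = if positive e then node e else node (node (node e)).
Proof.
case/tait_edgesP=> _ oe _; rewrite /under /overstrand_out.
by rewrite -[over _]/(~~ @over D e) oe.
Qed.

Lemma underK : {in X, cancel under (@overstrand_out D)}.
Proof.
move=> e eX; have /tait_edgesP[ce oe ue] := eX; rewrite underE // /positive.
have u2 := out_node2 ce.
case: ifP => pe; rewrite /overstrand_out !over_crossing_node ?crossing_node // oe /=.
  by rewrite u2 ue /= node4.
by rewrite node4 ue.
Qed.

Lemma under_inj : {in X &, injective under}.
Proof. by move=> d e dX eX de; rewrite -(underK dX) de underK. Qed.

Lemma mirror_tait_edges : tait_edges (mirror D) = under @: X.
Proof.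
apply/setP => d; apply/idP/imsetP => [dX'|[e /tait_edgesP[ce _ _] ->]]; last first.
  exact: (@overstrand_outE (mirror D)).
have /tait_edgesP[cd _ _] := dX'; change (is_true (@crossing D d)) in cd.
exists (@overstrand_out D d); first exact: overstrand_outE.
have /setP/(_ (@overstrand_out D d)) := porbit_tait_edges cd.
rewrite in_setI in_set1 eqxx => /andP[dd _].
have ce : @crossing (mirror D) (@overstrand_out D d).
  by have /tait_edgesP[] := overstrand_outE cd.
have /setP/(_ d) := porbit_tait_edges ce.
by rewrite in_setI dX' andbT in_set1 porbit_sym dd => /esym/eqP.
Qed.

(** The first case occurs for negative [e], the second for positive [e]. The undirected form
    suffices for trees and connectivity. *)
Lemma mirror_ends : {in X, forall e,
  (tail (under e) = left_face e /\ head (under e) = right_face e) \/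
  (tail (under e) = right_face e /\ head (under e) = left_face e)}.
Proof.
move=> e eX; rewrite underE //; case: ifP => _; [right | left]; split=> //.
by rewrite /tail /left_face -[region _]/(@region D _) node4.
Qed.

Lemma mirror_sides : {in X, forall e,
  (left_face (under e) = tail e /\ right_face (under e) = head e) \/
  (left_face (under e) = head e /\ right_face (under e) = tail e)}.
Proof.
move=> e eX; rewrite underE //; case: ifP => _; [left | right]; split=> //.
- by rewrite /right_face /head -[LHS]/(@region D _) node4.
- by rewrite /left_face /head -[LHS]/(@region D _) node4.
by rewrite /right_face /tail -[LHS]/(@region D _) node4.
Qed.

(** Negative external edges become the positive internal edges of the mirror, so the sign assumed
    here is the one that is counted. Dually, [mirror_left_face] concerns the positive internal
    edges. *)
Lemma mirror_tail e : e \in X -> ~~ positive e ->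
  tail (under e) = left_face e.
Proof.
move=> eX /negPf ne; rewrite underE // ne.
by rewrite /left_face /tail -[LHS]/(@region D _) node4.
Qed.

Lemma mirror_left_face e : e \in X -> positive e ->
  left_face (under e) = tail e.
Proof. by move=> eX pe; rewrite underE // pe. Qed.

Lemma mirror_positive e : e \in X -> positive (under e) = ~~ positive e.
Proof.
move=> eX; have /tait_edgesP[ce _ ue] := eX; rewrite underE // /positive.
rewrite -[LHS]/(@out D (node _)); case: ifP => _; last by rewrite node4 ue.
by rewrite out_node2 // ue.
Qed.

Lemma mirror_spanning_tree T : T \subset X ->
  spanning_tree (D := mirror D) S' (under @: (X :\: T)) = spanning_tree S T.
Proof.
move=> sTX; have sXT : X :\: T \subset X := subsetDl _ _.
rewrite (dual_tree shS) // spanning_treeE mirror_tait_edges imsetS //=.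
by rewrite (spans_imset mirror_ends) // (acyclic_imset under_inj mirror_ends).
Qed.

Lemma mirror_int_semi_active T e : spanning_tree S T -> e \in X :\: T ->
  ~~ positive e ->
  int_semi_active (D := mirror D) q (under @: (X :\: T)) (under e) =
  ext_semi_active q T e.
Proof.
move=> spT eXT ne; have := spT; rewrite spanning_treeE => /and3P[sTX _ _].
have sXT : X :\: T \subset X := subsetDl _ _.
rewrite (ext_semi_activeE shS) // /int_semi_active mirror_tail ?(subsetP sXT) //.
rewrite -[RHS](connect_adj_imset mirror_ends (A := X :\: (e |: T))) ?subsetDl //.
rewrite setUC -setDDl (imsetD_in under_inj (B := [set e])) //.
  by rewrite imset_set1.
by rewrite sub1set (subsetP sXT).
Qed.

Lemma mirror_ext_semi_active T e : spanning_tree S T -> e \in T ->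
  positive e ->
  ext_semi_active (D := mirror D) r (under @: (X :\: T)) (under e) =
  int_semi_active r T e.
Proof.
move=> spT eT pe; have := spT; rewrite spanning_treeE => /and3P[sTX _ _].
have sXT : X :\: T \subset X := subsetDl _ _.
have TE : X :\: (X :\: T) = T by rewrite setDDr setDv set0U (setIidPr sTX).
have eX := subsetP sTX e eT.
have spT' : spanning_tree (D := mirror D) S' (under @: (X :\: T)).
  by rewrite mirror_spanning_tree.
have eXT' : under e \in tait_edges (mirror D) :\: under @: (X :\: T).
  by rewrite mirror_tait_edges -(imsetD_in under_inj) // TE imset_f.
have rS' : r \in porbits (face D) :\: S'.
  case: shS => sS _ _; rewrite setDDr setDv set0U (setIidPr sS) //.
rewrite (@ext_semi_activeE (mirror D) S') //; last exact: compl_shading.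
rewrite mirror_left_face // /int_semi_active.
rewrite -[RHS](connect_adj_imset mirror_sides); last first.
  exact: subset_trans (subsetDl _ _) sTX.
(* The mirror edges outside the dual tree and the edge [under e] are the duals of [T :\ e]. *)
rewrite /fadj mirror_tait_edges -imsetU1 -(imsetD_in under_inj) //; last first.
  by rewrite subUset sub1set eX.
by rewrite setUC -setDDl TE.
Qed.

Lemma tree_sum_mirror (R : comPzRingType) (a b c d : R) :
  tree_sum (D := mirror D) S' q r a b c d = tree_sum S r q c d a b.
Proof.
have spX T : spanning_tree S T -> T \subset X.
  by rewrite spanning_treeE => /and3P[].
rewrite /tree_sum (sum_imset _ under_inj
  (p := fun T => (T \subset X) && spanning_tree S (X :\: T))); first last.
- move=> T sTX; rewrite sTX -mirror_spanning_tree ?subsetDl //.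
  by rewrite setDDr setDv set0U (setIidPr sTX).
- by move=> T; rewrite spanning_treeE mirror_tait_edges => /and3P[].
- by move=> T /andP[].
(* The trees of the mirror are the images of complements [U]; from here on the term is expressed
   through the tree [T] of [D]. *)
rewrite [RHS](sum_compl _ spX); apply: eq_bigr => U /andP[sUX spT].
move: (spX _ spT) (spT); set T := X :\: U => sTX {}spT.
have <- : X :\: T = U by rewrite setDDr setDv set0U (setIidPr sUX).
have sXT : X :\: T \subset X := subsetDl _ _.
have TE : X :\: (X :\: T) = T by rewrite setDDr setDv set0U (setIidPr sTX).
have -> : iota_pos (D := mirror D) q (under @: (X :\: T)) = eps_neg q T.
  apply: (card_imset_cond under_inj) => // e eXT.
  rewrite mirror_positive ?(subsetP sXT) //; case pe: (positive e) => //=.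
  by rewrite mirror_int_semi_active ?pe.
have -> : iota_bar_pos (D := mirror D) q (under @: (X :\: T)) = eps_bar_neg q T.
  apply: (card_imset_cond under_inj) => // e eXT.
  rewrite mirror_positive ?(subsetP sXT) //; case pe: (positive e) => //=.
  by rewrite mirror_int_semi_active ?pe.
have -> : eps_neg (D := mirror D) r (under @: (X :\: T)) = iota_pos r T.
  rewrite /eps_neg mirror_tait_edges -(imsetD_in under_inj) // TE.
  apply: (card_imset_cond under_inj) => // e eT.
  rewrite mirror_positive ?(subsetP sTX) // negbK; case pe: (positive e) => //=.
  by rewrite mirror_ext_semi_active.
have -> : eps_bar_neg (D := mirror D) r (under @: (X :\: T)) = iota_bar_pos r T.
  rewrite /eps_bar_neg mirror_tait_edges -(imsetD_in under_inj) // TE.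
  apply: (card_imset_cond under_inj) => // e eT.
  rewrite mirror_positive ?(subsetP sTX) // negbK; case pe: (positive e) => //=.
  by rewrite mirror_ext_semi_active.
by rewrite -mulrA mulrC mulrA.
Qed.

End ReverseMirror.

(** * Reversal and mirror image on link types *)

Lemma rewired_reverse (A B : diagram) (X : {set dart A}) nA eA :
  @rewired A B X nA eA -> @rewired (reverse A) (reverse B) X nA eA.
Proof.
case=> f [f_im f_node f_edge f_out f_over]; exists f; split=> // b.
by rewrite -[LHS]/(~~ @out A (f b)) f_out.
Qed.

Lemma rewired_mirror (A B : diagram) (X : {set dart A}) nA eA :
  @rewired A B X nA eA -> @rewired (mirror A) (mirror B) X nA eA.
Proof.
case=> f [f_im f_node f_edge f_out f_over]; exists f; split=> // b cb.
by rewrite -[LHS]/(~~ @over A (f b)) f_over.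
Qed.

Lemma move_reverse (A B : diagram) : move A B -> move (reverse A) (reverse B).
Proof.
case=> [AB|[|[|[|]]]]; first by left; apply: rewired_reverse.
- by case=> d [*]; right; left; exists d; split=> //; apply: rewired_reverse.
- by case=> d [*]; do 2!right; left; exists d; split=> //; apply: rewired_reverse.
- by case=> d [*]; do 3!right; left; exists d; split=> //; apply: rewired_reverse.
case=> p0 [p1 [p2 [*]]]; do 4!right; exists p0, p1, p2; split=> //.
exact: rewired_reverse.
Qed.

(** The conditions of the second and third moves only compare values of [over] with each other,
    hence survive negating all of them. *)
Lemma move_mirror (A B : diagram) : move A B -> move (mirror A) (mirror B).
Proof.
case=> [AB|[|[|[|]]]]; first by left; apply: rewired_mirror.
- by case=> d [*]; right; left; exists d; split=> //; apply: rewired_mirror.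
- by case=> d [*]; do 2!right; left; exists d; split=> //; apply: rewired_mirror.
- case=> d [? ? ? oad ?]; do 3!right; left; exists d; split=> //.
    by rewrite -[LHS]/(~~ over (edge d)) oad.
  exact: rewired_mirror.
case=> p0 [p1 [p2 [? ? ? alt ?]]]; do 4!right; exists p0, p1, p2; split=> //.
  rewrite -[X in ~~ X]/((~~ @over A p0 == ~~ over p1) &&
                        (~~ over p1 == ~~ over p2)).
  by rewrite !(inj_eq negb_inj).
exact: rewired_mirror.
Qed.

Lemma link_equiv_trans (A B C : diagram) :
  link_equiv A B -> link_equiv B C -> link_equiv A C.
Proof. exact: rst_trans. Qed.

Lemma link_equiv_map (f : diagram -> diagram) :
  (forall A B, move A B -> move (f A) (f B)) ->
  forall A B, link_equiv A B -> link_equiv (f A) (f B).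
Proof.
move=> f_move A B; elim=> [C C' /f_move|C|C C' _|C C' C'' _ IH _ IH'].
- exact: rst_step.
- exact: rst_refl.
- exact: rst_sym.
exact: rst_trans IH IH'.
Qed.

Definition link_equiv_reverse := link_equiv_map move_reverse.
Definition link_equiv_mirror := link_equiv_map move_mirror.

(** [~~ ~~ out d] is not convertible to [out d], so the involution is stated up to an [iso_move]
    along the identity. *)
Lemma reverseK K : link_equiv K (reverse (reverse K)).
Proof.
apply: rst_step; left; exists id; split=> // [|b].
  by split=> // a; rewrite inE codom_f.
by rewrite -[RHS]/(~~ ~~ @out K b) negbK.
Qed.

Lemma mirrorK K : link_equiv K (mirror (mirror K)).
Proof.
apply: rst_step; left; exists id; split=> // [|b _].
  by split=> // a; rewrite inE codom_f.
by rewrite -[RHS]/(~~ ~~ @over K b) negbK.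
Qed.

Lemma nonsplit_reverse K : nonsplit K -> nonsplit (reverse K).
Proof.
move=> nsK D /link_equiv_reverse rKD.
exact: (nsK (reverse D)) (link_equiv_trans (reverseK K) rKD).
Qed.

Lemma nonsplit_mirror K : nonsplit K -> nonsplit (mirror K).
Proof.
move=> nsK D /link_equiv_mirror rKD.
exact: (nsK (mirror D)) (link_equiv_trans (mirrorK K) rKD).
Qed.

Lemma run_reverse (D : diagram) (d d' : dart D) :
  @run (reverse D) d d' -> run d d'.
Proof. by elim=> [e|e e' _ ee' ce']; [exact: run_edge | exact: run_plain]. Qed.

Lemma run_mirror (D : diagram) (d d' : dart D) :
  @run (mirror D) d d' -> run d d'.
Proof. by elim=> [e|e e' _ ee' ce']; [exact: run_edge | exact: run_plain]. Qed.

Lemma alternating_reverse D : alternating D -> alternating (reverse D).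
Proof. by move=> altD d d' cd cd' /run_reverse; apply: altD. Qed.

Lemma alternating_mirror D : alternating D -> alternating (mirror D).
Proof.
move=> altD d d' cd cd' /run_mirror dd'.
by rewrite -[LHS]/(~~ @over D d') (altD d d').
Qed.

Lemma alternating_link_reverse K :
  alternating_link K -> alternating_link (reverse K).
Proof.
case=> D KD altD; exists (reverse D); first exact: link_equiv_reverse.
exact: alternating_reverse.
Qed.

Lemma alternating_link_mirror K :
  alternating_link K -> alternating_link (mirror K).
Proof.
case=> D KD altD; exists (mirror D); first exact: link_equiv_mirror.
exact: alternating_mirror.
Qed.

(** * Checkerboard colouring of alternating diagrams *)

Section Colouring.
Variable D : diagram.
Implicit Types d : dart D.

Lemma run_cat d1 d2 d3 :
  run d1 d2 -> ~~ crossing d2 -> run (node d2) d3 -> run d1 d3.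
Proof.
move=> r12 c2; move nd: (node d2) => d2' r23.
elim: r23 nd => [e <-|e e' _ IH ce' de]; first exact: run_plain.
by apply: run_plain => //; apply: IH.
Qed.

Lemma run_sym d d' : run d d' -> run d' d.
Proof.
elim=> [e|e e' _ IH ce']; first by rewrite -{2}(edge2 e); apply: run_edge.
apply: (@run_cat _ (node e')); rewrite ?crossing_node ?node_plain //.
by rewrite -{2}(edge2 (node e')); apply: run_edge.
Qed.

Lemma run_edge_plain d d' : run (edge d) d' -> d' = d \/ run (node d) d'.
Proof.
move de: (edge d) => e r; elim: r de => [{}e de|{}e e' _ IH ce' de].
  by left; rewrite -de edge2.
right; case: (IH de) => [->|]; first exact: run_edge.
by move/run_plain; apply.
Qed.

Lemma run_inv d d' : run d d' ->
  edge d' = d \/ exists2 e, run d e & edge d' = node e.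
Proof. by case=> [e|e e' r _]; [left | right; exists e']; rewrite ?edge2. Qed.

(** A walk that meets only plain points traces a closed component, whose darts are stable under
    [node] and [edge]. By connectedness it would contain [c]. *)
Lemma run_crossing d (c : dart D) : connected D -> crossing c ->
  exists2 d' : dart D, crossing d' & run d d'.
Proof.
move=> connD cc; apply: NNPP => no_cross.
have plain (d' : dart D) : run d d' -> ~~ crossing d'.
  by move=> r; apply/negP => cd'; apply: no_cross; exists d'.
pose walked e := exists2 d' : dart D, run d d' & e = d' \/ e = node d'.
pose w : {perm dart D} := (edge * node)%g.
have run_w i : run d (edge ((w ^+ i)%g d)).
  elim: i => [|i IH]; first by rewrite expg0 perm1; apply: run_edge.
  by rewrite expgSr permM permM; apply: run_plain => //; apply: plain.
(* While all nodes met are plain, [w] is one step of the walk. It has finite order, so the last step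
   of a period returns to [d]. *)
have walked_d : walked d.
  exists (edge ((w ^+ #[w]%g.-1)%g d)) => //; right.
  by rewrite -[RHS]permM -[RHS]permM -expgSr prednK ?order_gt0 // expg_order perm1.
have walked_node e : walked e -> walked (node e).
  case=> d' r [->|->]; exists d' => //; first by right.
  by left; rewrite node_plain ?plain.
have walked_edge e : walked e -> walked (edge e).
  case=> d' r [->|->]; last by exists (edge (node d'));
    [apply: run_plain => //; apply: plain | left].
  by case: (run_inv r) => [->|[d'' r' ->]] //; exists d''; last by right.
have walked_c x : connect (link_of node edge) d x -> walked x.
  case/connectP=> p; elim/last_ind: p x => [|p y IH] x; first by move=> _ ->.
  rewrite rcons_path last_rcons => /andP[dp /orP[]/eqP xE ->]; rewrite xE.
    by apply: walked_node; apply: IH.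
  by apply: walked_edge; apply: IH.
have [d' r cE] := walked_c c (connected_connect d c connD).
by have /negP[] := plain d' r; case: cE cc => ->; rewrite ?crossing_node.
Qed.

(** At a crossing the colour must be [over d]. By alternation this is the negation of [over] at the
    next crossing along [d], a formula that also makes sense at plain points. A diagram without
    crossings is coloured by its orientation. *)
Lemma alternating_colouring : connected D -> alternating D ->
  exists col : dart D -> bool, [/\ forall d, col (edge d) = ~~ col d,
    forall d, col (node d) = ~~ col d
  & forall d : dart D, crossing d -> over d -> col d].
Proof.
move=> connD altD.
have [/existsP[c cc]|] := boolP [exists c : dart D, crossing c];
  last first.
  move/existsPn => no_cross; exists out; split=> d; first exact: out_edge.
    exact: out_plain.
  by rewrite (negPf (no_cross d)).
(* At a plain point, walk the other way to a crossing [d3]: both [d1] and [d2] are then joined to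
   [d3] by runs, so alternation fixes [over] at each of them. *)
have over_run d d1 d2 : crossing d1 -> crossing d2 -> run d d1 -> run d d2 ->
    over d1 = over d2.
  move=> c1 c2 r1 r2; have [cd|cd] := boolP (crossing d).
    by rewrite (altD d d1) // (altD d d2).
  have [d3 c3 r3] := run_crossing (node d) connD cc.
  apply: negb_inj; rewrite -(altD d1 d3) // -?(altD d2 d3) //.
    exact: run_cat (run_sym r2) cd r3.
  exact: run_cat (run_sym r1) cd r3.
have /fin_all_exists[col colP] (d : dart D) :
    exists b : bool, exists2 d' : dart D, crossing d' & run d d' /\ b = ~~ over d'.
  have [d' cd' r] := run_crossing d connD cc.
  by exists (~~ over d'), d'.
have colE d d' : crossing d' -> run d d' -> col d = ~~ over d'.
  move=> cd' r; have [d1 c1 [r1 ->]] := colP d.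
  by rewrite (over_run d d1 d').
have col_over d : crossing d -> col d = over d.
  by move=> cd; have [d1 c1 [r1 ->]] := colP d; rewrite (altD d d1) // negbK.
have col_node d : col (node d) = ~~ col d.
  have [cd|cd] := boolP (crossing d).
    by rewrite !col_over ?crossing_node // over_crossing_node.
  have [d1 c1 [r1 ->]] := colP d; have [d3 c3 [r3 ->]] := colP (node d).
  rewrite (altD d1 d3) //; exact: run_cat (run_sym r1) cd r3.
have col_edge_plain d : ~~ crossing d -> col (edge d) = ~~ col d.
  move=> cd; rewrite -col_node; have [d2 c2 [r2 ->]] := colP (edge d).
  case: (run_edge_plain r2) => [dd|r]; first by rewrite dd (negPf cd) in c2.
  by rewrite (colE _ _ c2 r).
exists col; split=> [d|//|d cd]; last by rewrite col_over.
have [cd|/col_edge_plain//] := boolP (crossing d).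
have [ce|ce] := boolP (crossing (edge d)); last first.
  by rewrite -{2}(edge2 d) (col_edge_plain (edge d)) // negbK.
by rewrite !col_over // (altD d (edge d)) //; apply: run_edge.
Qed.

(** [face] is one [edge] followed by one inverse [node]; each flips the colour, so the colour is
    constant on regions. *)
Lemma colouring_shading (col : dart D -> bool) :
  (forall d, col (edge d) = ~~ col d) -> (forall d, col (node d) = ~~ col d) ->
  (forall d : dart D, crossing d -> over d -> col d) ->
  tait_shading [set region d | d in col] /\
  (forall d, (region d \in [set region d | d in col]) = col d).
Proof.
move=> col_edge col_node col_over.
have col_face d : col (face D d) = col d.
  rewrite /face /face_of permM; apply: negb_inj.
  by rewrite -col_node permKV col_edge.
have col_region d d' : region d = region d' -> col d = col d'.
  move/eqP; rewrite eq_porbit_mem => /porbitP[i ->].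
  by rewrite permX; elim: i => //= i IH; rewrite col_face.
have regE d : (region d \in [set region d | d in col]) = col d.
  apply/imsetP/idP => [[d' cd' /col_region ->]//|cd].
  by exists d.
split=> //; split=> [|d|d cd od].
- by apply/subsetP => _ /imsetP[d _ ->]; apply: imset_f.
- by rewrite !regE col_edge.
by rewrite regE col_over.
Qed.

End Colouring.

(** [P_well_defined] gives only uniqueness; this existence makes the value chosen by [epsilon]
    meaningful. *)
Lemma ex_computes_P K : nonsplit K -> alternating_link K ->
  exists (D : diagram) (S : {set {set dart D}}) (r q : {set dart D}),
    [/\ link_equiv K D, alternating D, connected D, tait_shading S
      & adjacent_pair S r q].
Proof.
move=> nsK [D KD altD]; have connD := nsK D KD.
have [col [col_edge col_node col_over]] := alternating_colouring connD altD.
have [shS SE] := colouring_shading col_edge col_node col_over.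
(* The number of components is 1 and is bounded by the number of darts. *)
have /card_gt0P[d0 _] : (0 < #|dart D|)%N.
  move/eqP: connD => <-; exact: max_card.
have [d cd] : exists d, col d.
  by have := col_edge d0; case cd: (col d0) => ce; [exists d0 | exists (edge d0)].
exists D, [set region d | d in col], (region d), (region (edge d)).
by split=> //; split; [rewrite SE | exists d].
Qed.

Theorem proposition4p7
  (P_wd : P_well_defined)
  (K : diagram) (K_nonsplit : nonsplit K) (K_alt : alternating_link K)
  (R : comUnitRingType) (x y z w : R)
  (x_unit : x \is a GRing.unit) (y_unit : y \is a GRing.unit)
  (z_unit : z \is a GRing.unit) (w_unit : w \is a GRing.unit) :
  laurent_eval (P (reverse K)) x y z w = laurent_eval (P K) y x w z /\
  laurent_eval (P (mirror K)) x y z w =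
    laurent_eval (P K) z^-1 w^-1 x^-1 y^-1.
Proof.
have PE L p : nonsplit L -> alternating_link L -> computes_P L p -> P L = p.
  move=> nsL altL Lp; apply: (P_wd L) => //.
  by apply: epsilon_spec; exists p.
have [D [S [r [q [KD altD connD shS rqS]]]]] := ex_computes_P K_nonsplit K_alt.
have [rS [d [rE qE]]] := rqS.
have qS' : q \in porbits (face D) :\: S.
  by rewrite qE region_in_compl (region_edge shS) negbK -rE.
rewrite (PE K (tree_polynomial S r q)) //; last by exists D, S, r, q.
split.
  rewrite (PE (reverse K) (tree_polynomial (D := reverse D) S r q)).
  - by rewrite !laurent_eval_tree (tree_sum_reverse connD shS rS qS').
  - exact: nonsplit_reverse.
  - exact: alternating_link_reverse.
  exists (reverse D), S, r, q; split=> //.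
    exact: link_equiv_reverse.
  exact: alternating_reverse.
(* In the dual, [q] becomes the root and [r] the face containing the basepoint; they are adjacent
   along the same arc, read from its other end. *)
rewrite (PE (mirror K)
  (tree_polynomial (D := mirror D) (porbits (face D) :\: S) q r)).
- by rewrite !laurent_eval_tree (tree_sum_mirror connD shS rS qS') !invrK.
- exact: nonsplit_mirror.
- exact: alternating_link_mirror.
exists (mirror D), (porbits (face D) :\: S), q, r; split=> //.
- exact: link_equiv_mirror.
- exact: alternating_mirror.
- exact: compl_shading.
split=> //; exists (edge d); rewrite -[region _]/(@region D (edge d)) //.
by rewrite edge2.
Qed.
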